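(* For a set partition $\mathbf{A}$ of $[n]$ with $r$ parts, let $\Gamma'(r)$ denote the set of set compositions $\gamma=(\gamma_1,\dots,\gamma_s)$ of $[r]$ with $1\in\gamma_1$, and put $$p(\mathbf{A}) := \sum_{\gamma\in\Gamma'(r)} (-1)^{\ell(\gamma)-1}\,\gamma[\mathbf{A}]\ \in\ \mathrm{NCSym}.$$ Let $\dot\Pi$ be the set of all atomic set partitions. Then the set $\{p(\mathbf{A})\mid\mathbf{A}\in\dot\Pi\}$ comprises irredundant (algebraically independent) generators of the Lie algebra of primitive elements of $\mathrm{NCSym}$; that is, the elements $p(\mathbf{A})$, $\mathbf{A}\in\dot\Pi$, generate the Lie algebra of primitive elements of $\mathrm{NCSym}$ (under the commutator bracket), and they are algebraically independent in $\mathrm{NCSym}$.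
   Context: Let $\mathbb{P}$ be the set of positive integers, $[n]=\{1,\dots,n\}$ and $[0]=\emptyset$. Set partitions. A set partition of a finite set $X\subseteq\mathbb{P}$ is a set $\mathbf{A}=\{A_1,\dots,A_r\}$ of nonempty, pairwise disjoint subsets (parts) of $X$ with union $X$. Parts are always indexed in increasing order of their minimum elements. The empty set has a unique set partition, denoted $\boldsymbol{\emptyset}$ (with $r=0$ parts). Let $\Pi(n)$ be the set of set partitions of $[n]$. For a set partition $\mathbf{A}$ with $r$ parts and $K\subseteq[r]$, let $\mathbf{A}_K=\{A_k\mid k\in K\}$. For a set partition $\mathbf{A}$ of an $n$-element set $X$, its standardization $\mathbf{A}^{\downarrow}\in\Pi(n)$ is the pullback of $\mathbf{A}$ along the unique increasing bijection $[n]\to X$. For $\mathbf{B}\in\Pi(m)$ and $\mathbf{C}\in\Pi(n)$, $\mathbf{B}|\mathbf{C}\in\Pi(m+n)$ is the set partition $\mathbf{B}\cup\mathbf{C}^{+m}$, where $\mathbf{C}^{+m}$ is obtained from $\mathbf{C}$ by adding $m$ to every element of every part. Atomic. A set partition $\mathbf{A}$ of $[n]$, $n\ge1$, is atomic if there do not exist a subset $\mathbf{B}\subseteq\mathbf{A}$ and an integer $1\le m<n$ such that $\mathbf{B}$ is a set partition of $[m]$ (equivalently, $\mathbf{A}$ is not of the form $\mathbf{B}|\mathbf{C}$ with $\mathbf{B}\in\Pi(n')$, $\mathbf{C}\in\Pi(n'')$, $n',n''\ge1$). Set compositions. A set composition of a finite set $K\subseteq\mathbb{P}$ is a sequence $\gamma=(\gamma_1,\dots,\gamma_s)$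 of nonempty, pairwise disjoint subsets of $K$ with union $K$; its length is $\ell(\gamma)=s$. If $\mathbf{A}$ is a set partition with $r$ parts and $\gamma=(\gamma_1,\dots,\gamma_s)$ is a set composition of some $K\subseteq[r]$, define $$\gamma[\mathbf{A}] := (\mathbf{A}_{\gamma_1})^{\downarrow}\,|\,(\mathbf{A}_{\gamma_2})^{\downarrow}\,|\,\cdots\,|\,(\mathbf{A}_{\gamma_s})^{\downarrow}.$$ The Hopf algebra. $\mathrm{NCSym}=\bigoplus_{n\ge0}\mathrm{NCSym}_n$ is the graded $\mathbb{Q}$-vector space where $\mathrm{NCSym}_n$ has basis $\Pi(n)$. It is a graded connected cocommutative Hopf algebra with product $\mathbf{A}\cdot\mathbf{B}=\mathbf{A}|\mathbf{B}$, unit $\boldsymbol{\emptyset}$, coproduct $$\Delta(\mathbf{A})=\sum_{(K,L)} (\mathbf{A}_K)^{\downarrow}\otimes(\mathbf{A}_L)^{\downarrow}$$ for $\mathbf{A}$ with $r$ parts, the sum being over ordered pairs $(K,L)$ of (possibly empty) subsets with $K\cup L=[r]$, $K\cap L=\emptyset$, and counit $\varepsilon(\mathbf{A})=0$ for $\mathbf{A}\ne\boldsymbol{\emptyset}$, $\varepsilon(\boldsymbol{\emptyset})=1$. An element $p$ is primitive if $\Delta(p)=p\otimes1+1\otimes p$; primitive elements form a Lie algebra under $[x,y]=xy-yx$. Algebraic independence of a family in the noncommutative algebra $\mathrm{NCSym}$ means that no nonzero polynomial in noncommuting variables (with coefficients in $\mathbb{Q}$) vanishes on (distinct members of) the family,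 i.e. the canonical algebra map from the free associative algebra on the family to $\mathrm{NCSym}$ is injective. *)

(* Defs.v *)
From HB Require Import structures.
From mathcomp Require Import all_boot all_order all_algebra.
From mathcomp Require Import finmap.
From mathcomp.multinomials Require Import monalg.

Set Implicit Arguments.
Unset Strict Implicit.
Unset Printing Implicit Defensive.

Import GRing.Theory.

Local Open Scope fset_scope.

Notation set_family := {fset {fset nat}}.

Definition interval_1 (n : nat) : {fset nat} := [fset i in iota 1 n].

Definition partition_of (X : {fset nat}) (A : set_family) : bool :=
  [&& fset0 \notin A, trivIfset A & fcover A == X].

Definition nparts (A : set_family) : nat := #|` A|.

Definition degree (A : set_family) : nat := #|` fcover A|.

(** [setpart] is the disjoint union of the sets [Pi(n)]: the only possible [n]
    is the cardinal of the union of the parts. *)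
Definition is_setpart (A : set_family) : bool :=
  partition_of (interval_1 (degree A)) A.

Record setpart := Setpart { parts :> set_family; _ : is_setpart parts }.

HB.instance Definition _ := [isSub for parts].
HB.instance Definition _ := [Choice of setpart by <:].

Definition image_family (f : nat -> nat) (A : set_family) : set_family :=
  [fset [fset f x | x in (a : {fset nat})] | a : {fset nat} in A].

(** [x] goes to its rank in [X], counted from 1. On [X] this is the inverse of
    the increasing bijection from [{1, ..., #|X|}] to [X], so that taking images
    under it is pulling back along that bijection. *)
Definition rank_in (X : {fset nat}) (x : nat) : nat :=
  #|` [fset y in X | (y <= x)%N]|.

Definition standardize (A : set_family) : set_family :=
  image_family (rank_in (fcover A)) A.

Definition slash (B C : set_family) : set_family :=
  B `|` image_family (addn (degree B)) C.

Definition min_elt (b : {fset nat}) : nat := head 0%N (sort leq b).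

Definition ordered_parts (A : set_family) : seq {fset nat} :=
  sort (fun b c : {fset nat} => (min_elt b <= min_elt c)%N) A.

(** [A_K]. The indices are shifted down by one: [k : 'I_r] stands for the
    part of index [k + 1]. *)
Definition subparts (A : set_family) (K : {set 'I_(nparts A)}) : set_family :=
  [fset nth fset0 (ordered_parts A) (k : 'I_(nparts A)) | k in K].

Lemma in_interval_1 n x : (x \in interval_1 n) = (0 < x <= n)%N.
Proof. by rewrite in_fset_ /= mem_iota add1n ltnS. Qed.

Lemma card_interval_1 n : #|` interval_1 n| = n.
Proof. by rewrite card_fseq undup_id ?iota_uniq // size_iota. Qed.

Lemma fcoverP (A : set_family) x :
  reflect (exists2 a, a \in A & x \in a) (x \in fcover A).
Proof.
apply: (iffP (bigfcupP _ _ _ _)) => [[a /andP[aA _] xa]|[a aA xa]].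
  by exists a.
by exists a => //; rewrite aA.
Qed.

Lemma partition_ofP (X : {fset nat}) (A : set_family) :
  reflect
    [/\ fset0 \notin A,
        forall a b x, a \in A -> b \in A -> x \in a -> x \in b -> a = b
      & fcover A = X]
    (partition_of X A).
Proof.
apply: (iffP and3P) => -[A0 tA cA].
  split=> // [a b x aA bA xa xb|]; last exact/eqP.
  apply/eqP/negPn/negP => neq.
  by move/trivIfsetP: tA => /(_ a b aA bA neq)/fdisjointP/(_ x xa)/negP.
split=> //; last exact/eqP.
apply/trivIfsetP => a b aA bA neq; apply/fdisjointP => x xa.
by apply: contra neq => xb; apply/eqP/(tA _ _ x).
Qed.

Lemma setpartP (A : setpart) : partition_of (interval_1 (degree A)) A.
Proof. by case: A. Qed.

Lemma image_familyP (f : nat -> nat) (A : set_family) b :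
  reflect (exists2 a, a \in A & b = [fset f x | x in (a : {fset nat})])
          (b \in image_family f A).
Proof. by apply: (iffP (imfsetP _ _ _ _)) => -[a aA ->]; exists a. Qed.

Lemma fcover_image (f : nat -> nat) (A : set_family) :
  fcover (image_family f A) = [fset f x | x in fcover A].
Proof.
apply/fsetP => y; apply/fcoverP/imfsetP => /=.
  move=> [_ /image_familyP[a aA ->] /imfsetP[x /= xa ->]].
  by exists x => //; apply/fcoverP; exists a.
move=> [x /fcoverP[a aA xa] ->].
exists [fset f x | x in a]; last exact: in_imfset.
by apply/image_familyP; exists a.
Qed.

Lemma partition_image (f : nat -> nat) (X : {fset nat}) (A : set_family) :
  {in X &, injective f} -> partition_of X A ->
  partition_of [fset f x | x in X] (image_family f A).
Proof.
move=> fI /partition_ofP[A0 tA cA]; apply/partition_ofP; split.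
- apply/image_familyP => -[a aA a0].
  have: a != fset0 by apply: contraNneq A0 => <-.
  by case/fset0Pn => x xa; have := in_imfset imfset_key f xa; rewrite -a0.
- move=> _ _ y /image_familyP[a aA ->] /image_familyP[b bA ->].
  move=> /imfsetP[x /= xa ->] /imfsetP[z /= zb /fI xz].
  suff -> : a = b by [].
  by apply: (tA _ _ x) => //; rewrite xz // -cA;
    apply/fcoverP; [exists a|exists b].
- by rewrite fcover_image cA.
Qed.

Lemma partition_sub (X : {fset nat}) (A B : set_family) :
  B `<=` A -> partition_of X A -> partition_of (fcover B) B.
Proof.
move=> /fsubsetP BA /partition_ofP[A0 tA _]; apply/partition_ofP; split=> //.
  by apply: contra A0; apply: BA.
by move=> a b x /BA aA /BA bA; apply: tA.
Qed.

Lemma rank_inj (X : {fset nat}) : {in X &, injective (rank_in X)}.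
Proof.
have lt x y : y \in X -> (x < y)%N -> (rank_in X x < rank_in X y)%N.
  move=> yX xy; apply: fproper_ltn_card; rewrite fproperE.
  apply/andP; split.
    apply/fsubsetP => z; rewrite !inE /= => /andP[-> zx].
    exact: leq_trans zx (ltnW xy).
  by apply/negP => /fsubsetP/(_ y);
    rewrite !inE /= yX leqnn leqNgt xy => /(_ isT).
move=> x y xX yX e; case: (ltngtP x y) => // h.
  by have := lt _ _ yX h; rewrite e ltnn.
by have := lt _ _ xX h; rewrite e ltnn.
Qed.

Lemma rank_image (X : {fset nat}) :
  [fset rank_in X x | x in X] = interval_1 #|` X|.
Proof.
apply/eqP; rewrite eqEfcard card_interval_1 card_in_imfset ?leqnn ?andbT //=;
  last exact: rank_inj.
apply/fsubsetP => _ /imfsetP[x /= xX ->]; rewrite in_interval_1.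
apply/andP; split; last by apply: fsubset_leq_card; apply: fset_sub.
by rewrite cardfs_gt0; apply/fset0Pn; exists x; rewrite !inE /= xX leqnn.
Qed.

Lemma standardize_setpart (A : set_family) :
  partition_of (fcover A) A -> is_setpart (standardize A).
Proof.
move=> pA; rewrite /is_setpart /degree.
have -> : fcover (standardize A) = interval_1 #|` fcover A|.
  by rewrite fcover_image rank_image.
rewrite card_interval_1 -rank_image; apply: partition_image => //.
exact: rank_inj.
Qed.

Lemma subparts_sub (A : set_family) (K : {set 'I_(nparts A)}) :
  subparts K `<=` A.
Proof.
apply/fsubsetP => _ /imfsetP[k /= _ ->].
have: nth fset0 (ordered_parts A) k \in ordered_parts A.
  by rewrite mem_nth // size_sort.
by rewrite mem_sort.
Qed.

Lemma subparts_setpart (A : setpart) (K : {set 'I_(nparts A)}) :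
  is_setpart (standardize (subparts K)).
Proof.
by apply: standardize_setpart; apply: partition_sub (setpartP A);
  apply: subparts_sub.
Qed.

(** The standardization of [A_K]. *)
Definition std_subparts (A : setpart) (K : {set 'I_(nparts A)}) : setpart :=
  Setpart (subparts_setpart K).

Lemma degree_image (f : nat -> nat) (A : set_family) :
  injective f -> degree (image_family f A) = degree A.
Proof. by move=> fI; rewrite /degree fcover_image card_imfset. Qed.

Lemma fcoverU (A B : set_family) : fcover (A `|` B) = fcover A `|` fcover B.
Proof.
apply/fsetP => x; rewrite inE; apply/fcoverP/orP.
  by move=> [a]; rewrite inE => /orP[] aA xa; [left|right];
    apply/fcoverP; exists a.
by case=> /fcoverP[a aA xa]; exists a; rewrite // inE aA ?orbT.
Qed.

Lemma shiftP m n x :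
  (x \in [fset (m + y)%N | y in interval_1 n]) = (m < x <= m + n)%N.
Proof.
apply/imfsetP/idP => /= [[y]|/andP[mx xn]].
  by rewrite in_interval_1 => /andP[y0 yn] ->; rewrite -addn1 !leq_add2l y0.
exists (x - m)%N; last by rewrite subnKC // ltnW.
by rewrite in_interval_1 subn_gt0 mx leq_subLR.
Qed.

Lemma fcover_slash (B C : setpart) :
  fcover (slash B C) = interval_1 (degree B + degree C).
Proof.
have /partition_ofP[_ _ cB] := setpartP B.
have /partition_ofP[_ _ cC] := setpartP C.
apply/fsetP => x; rewrite fcoverU fcover_image cC inE cB shiftP !in_interval_1.
case: x => [|x] //=; case: (leqP x.+1 (degree B)) => //= h.
by rewrite (leq_trans h) // leq_addr.
Qed.

Lemma degree_slash (B C : setpart) :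
  degree (slash B C) = (degree B + degree C)%N.
Proof. by rewrite /degree fcover_slash card_interval_1. Qed.

Lemma slash_setpart (B C : setpart) : is_setpart (slash B C).
Proof.
rewrite /is_setpart degree_slash.
have /partition_ofP[B0 tB cB] := setpartP B.
have pC := partition_image (in2W (@addnI (degree B))) (setpartP C).
have /partition_ofP[C0 tC cC] := pC.
have dis a b x : a \in (B : set_family) ->
    b \in image_family (addn (degree B)) C -> x \in a -> x \in b -> False.
  move=> aB bC xa xb.
  have : x \in fcover B by apply/fcoverP; exists a.
  have : x \in fcover (image_family (addn (degree B)) C).
    by apply/fcoverP; exists b.
  rewrite cB cC shiftP in_interval_1 => /andP[h _] /andP[_].
  by rewrite leqNgt h.
apply/partition_ofP; split; last exact: fcover_slash.
  by rewrite inE negb_or B0.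
move=> a b x; rewrite !inE => /orP[] aA /orP[] bA xa xb.
- exact: (tB _ _ x).
- by case: (dis _ _ _ aA bA xa xb).
- by case: (dis _ _ _ bA aA xb xa).
- exact: (tC _ _ x).
Qed.

(** [B | C]. *)
Definition bar (B C : setpart) : setpart := Setpart (slash_setpart B C).

Lemma empty_setpart : is_setpart fset0.
Proof.
have c0 : fcover (fset0 : set_family) = fset0 by rewrite /fcover big_seq_fset0.
apply/partition_ofP; split=> //.
by apply/fsetP => x; rewrite c0 in_interval_1 /degree c0 cardfs0; case: x.
Qed.

Definition emptyp : setpart := Setpart empty_setpart.

Lemma degree0 (A : setpart) : degree A = 0%N -> A = emptyp.
Proof.
move=> dA; apply/val_inj/fsetP => a /=; rewrite inE; apply/negP => aA.
have /partition_ofP[A0 _ _] := setpartP A.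
have: a != fset0 by apply: contraNneq A0 => <-.
case/fset0Pn => x xa; move/cardfs0_eq: dA => c0.
by have: x \in fcover A by [apply/fcoverP; exists a]; rewrite c0.
Qed.

Lemma image_familyU f (A B : set_family) :
  image_family f (A `|` B) = image_family f A `|` image_family f B.
Proof.
apply/fsetP => y; rewrite inE; apply/image_familyP/orP.
  by move=> [a]; rewrite inE => /orP[] aA ->; [left|right];
    apply/image_familyP; exists a.
by case=> /image_familyP[a aA ->]; exists a; rewrite // inE aA ?orbT.
Qed.

Lemma image_family_comp f g (A : set_family) :
  image_family f (image_family g A) = image_family (f \o g) A.
Proof.
have e (a : {fset nat}) : [fset f x | x in [fset g x | x in a]] =
    [fset (f \o g) x | x in a].
  apply/fsetP => y; apply/imfsetP/imfsetP => /= -[x].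
    by case/imfsetP => z /= za -> ->; exists z.
  by move=> xa ->; exists (g x) => //; apply: in_imfset.
apply/fsetP => y; apply/image_familyP/image_familyP => -[a].
  by case/image_familyP => b bA -> ->; exists b.
by move=> aA ->; exists [fset g x | x in a]; rewrite ?e //;
  apply/image_familyP; exists a.
Qed.

Lemma eq_image_family f g (A : set_family) :
  f =1 g -> image_family f A = image_family g A.
Proof.
move=> fg; have e (a : {fset nat}) : [fset f x | x in a] = [fset g x | x in a].
  by apply: eq_imfset.
by apply/fsetP => y; apply/image_familyP/image_familyP => -[a aA ->];
  exists a; rewrite // e.
Qed.

Lemma image_family_id (A : set_family) : image_family id A = A.
Proof.
have e (a : {fset nat}) : [fset id x | x in a] = a.
  by apply/fsetP => x; apply/imfsetP/idP => [[y /= ya ->]|xa] //; exists x.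
apply/fsetP => y; apply/image_familyP/idP => [[a aA ->]|yA]; first by rewrite e.
by exists y; rewrite ?e.
Qed.

Lemma barA : associative bar.
Proof.
move=> B C D; apply: val_inj; rewrite /= /slash image_familyU fsetUA.
congr (_ `|` _); rewrite image_family_comp; apply: eq_image_family => x.
by rewrite /= degree_slash addnA.
Qed.

Lemma bar0p : left_id emptyp bar.
Proof.
move=> B; apply: val_inj; rewrite /= /slash fset0U.
rewrite -[RHS]image_family_id; apply: eq_image_family => x.
by rewrite /degree /fcover big_seq_fset0 cardfs0.
Qed.

Lemma barp0 : right_id emptyp bar.
Proof.
move=> B; apply: val_inj; rewrite /= /slash.
suff -> : image_family (addn (degree B)) fset0 = fset0 by rewrite fsetU0.
by apply/fsetP => y; rewrite inE; apply/image_familyP => -[].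
Qed.

Lemma bar_eq0 (B C : setpart) : bar B C = emptyp -> B = emptyp /\ C = emptyp.
Proof.
move=> /(congr1 (fun A : setpart => degree A)) /=; rewrite degree_slash.
have -> : degree fset0 = 0%N by rewrite /degree /fcover big_seq_fset0 cardfs0.
by move/eqP; rewrite addn_eq0 => /andP[/eqP/degree0 -> /eqP/degree0 ->].
Qed.

HB.instance Definition _ :=
  Choice_isMonomialDef.Build setpart barA bar0p barp0 bar_eq0.

Definition atomic (A : setpart) : bool :=
  (0 < degree A)%N &&
  ~~ [exists m : 'I_(degree A), (0 < m)%N &&
       [exists B : fpowerset A, partition_of (interval_1 m) (val B)]].

Local Close Scope fset_scope.
Local Open Scope set_scope.

Definition set_composition (T : finType) (K : {set T}) (g : seq {set T}) :
    bool :=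
  [&& set0 \notin g,
      pairwise (fun B C : {set T} => [disjoint B & C]) g
    & (\bigcup_(B <- g) B) == K].

(** [g[A]]; [mmul] is [bar]. *)
Definition compose_parts (A : setpart) (g : seq {set 'I_(nparts A)}) :
    setpart :=
  \big[mmul/mone]_(K <- g) std_subparts K.

Local Open Scope ring_scope.

(** The monoid algebra of the set partitions under [bar]; [<< A >>] is the
    basis element of [A]. *)
Notation NCSym := {malg rat[setpart]}.

(** The tensor square of [NCSym], on the basis of pairs [(A, B)] standing for
    [A (x) B]. *)
Notation NCSym2 := {malg rat[(setpart * setpart)%type]}.

Definition tensor (x y : NCSym) : NCSym2 :=
  \sum_(A <- msupp x) \sum_(B <- msupp y) (x@_A * y@_B) *: << (A, B) >>.

Definition coproduct_basis (A : setpart) : NCSym2 :=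
  \sum_(KL : {set 'I_(nparts A)} * {set 'I_(nparts A)}
         | (KL.1 :|: KL.2 == [set: 'I_(nparts A)]) &&
           (KL.1 :&: KL.2 == set0))
    << (std_subparts KL.1, std_subparts KL.2) >>.

Definition coproduct (x : NCSym) : NCSym2 :=
  \sum_(A <- msupp x) x@_A *: coproduct_basis A.

Definition primitive (x : NCSym) : Prop :=
  coproduct x = tensor x 1 + tensor 1 x.

Definition bracket (x y : NCSym) : NCSym := x * y - y * x.

Record lie_subalgebra (L : NCSym -> Prop) : Prop := {
  lie0 : L 0;
  lieD : forall x y, L x -> L y -> L (x + y);
  lieZ : forall (c : rat) x, L x -> L (c *: x);
  lie_bracket : forall x y, L x -> L y -> L (bracket x y) }.

Definition lie_generated (S : NCSym -> Prop) (x : NCSym) : Prop :=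
  forall L, lie_subalgebra L -> (forall y, S y -> L y) -> L x.

(** The canonical map from the free associative algebra on [I], whose basis is
    the set of words in [I]. *)
Definition free_eval (I : choiceType) (v : I -> NCSym) :
    {malg rat[{fmonom I}]} -> NCSym :=
  mmap malgC (fun w : {fmonom I} => \prod_(i <- (w : seq I)) v i).

Definition algebraically_independent (I : choiceType) (v : I -> NCSym) : Prop :=
  injective (free_eval v).

(** [Gamma'(r)]. A set composition of [r] elements has length at most [r], so
    that bounded sequences account for all of them. *)
Definition composition_from_1 (r : nat) (g : seq {set 'I_r}) : bool :=
  set_composition [set: 'I_r] g &&
  [exists k : 'I_r, (k == 0%N :> nat) && (k \in head set0 g)].

Definition p_elt (A : setpart) : NCSym :=
  \sum_(g : (nparts A).-bseq {set 'I_(nparts A)} | composition_from_1 g)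
    (-1) ^+ (size g).-1 *: << compose_parts g >>.

(* Main.v *)
Require Import Defs.
From HB Require Import structures.
From mathcomp Require Import all_boot all_order all_algebra.
From mathcomp Require Import finmap.
From mathcomp.multinomials Require Import monalg.

(** Three facts carry the proof.

    The p(A) are primitive.  Fix a part a0 of A and extend the definition of
    p to the subfamilies B of A that contain a0, by the set compositions of B
    whose first block contains a0.  Splitting off the last block of a
    composition gives
      A_K = sum over B with a0 in B, B included in A_K, of p(B) | (A_K \ B)
    up to standardization ([composition_sum_rec]).  Since the coproduct is
    multiplicative ([coproductM]) and sums over the ways to cut a family in
    two ([coproduct_std]), applying it to this identity and inducting on the
    number of parts forces p(B) to be primitive: if every p(B) is replaced by
    the primitive p(B) (x) 1 + 1 (x) p(B), the sum over B folds back to the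
    coproduct of A_K ([coproduct_resum], [primitive_of_recursion]).

    The p(A), A atomic, are free generators of the algebra.  Every set
    partition is a product of atomic ones in exactly one way
    ([atomic_factorization], [word_prod_inj]), so the algebra is free on the
    atomic basis elements.  For A atomic, p(A) is A plus terms indexed by
    compositions with at least two blocks ([p_elt_lead]); these are products
    of at least two set partitions of smaller degree.  The substitution of
    p(A) for A is therefore unitriangular for the number of atomic factors:
    it is injective ([free_eval_inj]), and surjective by induction on the
    degree ([free_eval_basis]).

    Primitive elements are Lie elements.  This is the argument of Friedrichs
    and Dynkin for a free algebra on primitive generators.  Let D send a word
    a1 ... ak to the bracket [a1, [a2, ... , ak]].  The convolution of D with
    the identity multiplies each word by its length ([dynkin_convolution]),
    while on a primitive x it takes the value D(x).  Hence the derivation that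
    multiplies words by their length agrees with D on x ([primitive_dynkin]);
    dividing by the lengths, which is possible over the rationals, writes x as
    a combination of brackets plus a scalar, and the scalar is primitive, so
    zero ([primitive_lie_generated]). *)

Set Implicit Arguments.
Unset Strict Implicit.
Unset Printing Implicit Defensive.

Import GRing.Theory.
Local Open Scope ring_scope.

(** * Linear and bilinear maps on monoid algebras *)

Section LinearExtension.
Variables (K : choiceType) (R : comNzRingType).

Lemma malgEZ (x : {malg R[K]}) : x = \sum_(k <- msupp x) x@_k *: << k >>.
Proof.
rewrite {1}[x]monalgE; apply: eq_bigr => k _.
by apply/malgP => j; rewrite mcoeffZ !mcoeffU mulr_natr.
Qed.

Lemma malg_ind (P : {malg R[K]} -> Prop) :
  P 0 -> (forall x y, P x -> P y -> P (x + y)) ->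
  (forall c x, P x -> P (c *: x)) -> (forall k, P << k >>) ->
  forall x, P x.
Proof.
move=> P0 PD PZ PU x; rewrite [x]malgEZ.
by apply: (big_ind P) => // k _; apply: PZ.
Qed.

Variable V : lmodType R.

Definition lin_ext (f : K -> V) (x : {malg R[K]}) : V :=
  \sum_(k <- msupp x) x@_k *: f k.

Lemma lin_extEw f (d : {fset K}) x : (msupp x `<=` d)%fset ->
  lin_ext f x = \sum_(k <- d) x@_k *: f k.
Proof.
move=> le; rewrite [LHS](big_fset_incl _ le) => //= k _ /mcoeff_outdom ->.
by rewrite scale0r.
Qed.

Fact lin_ext_is_linear f : linear (lin_ext f).
Proof.
move=> c x y; set d := (msupp x `|` msupp y)%fset.
have sx : (msupp x `<=` d)%fset by apply: fsubsetUl.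
have sy : (msupp y `<=` d)%fset by apply: fsubsetUr.
have sz : (msupp (c *: x + y)%R `<=` d)%fset.
  apply: fsubset_trans (msuppD_le _ _) _; rewrite fsubUset sy andbT.
  exact: fsubset_trans (msuppZ_le _ _) sx.
rewrite !(@lin_extEw _ d) // scaler_sumr -big_split /=; apply: eq_bigr => k _.
by rewrite mcoeffD mcoeffZ scalerDl scalerA.
Qed.

HB.instance Definition _ f :=
  GRing.isLinear.Build R {malg R[K]} V *:%R (lin_ext f) (lin_ext_is_linear f).

Lemma lin_extU f k : lin_ext f << k >> = f k.
Proof.
by rewrite (@lin_extEw _ [fset k]%fset) ?msuppU_le // big_seq_fset1 mcoeffUU
  scale1r.
Qed.

Lemma eq_lin_ext f g : f =1 g -> lin_ext f =1 lin_ext g.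
Proof. by move=> fg x; apply: eq_bigr => k _; rewrite fg. Qed.

Lemma lin_extDf f g x :
  lin_ext (fun k => f k + g k) x = lin_ext f x + lin_ext g x.
Proof. by rewrite -big_split; apply: eq_bigr => k _; rewrite scalerDr. Qed.

Lemma lin_extZf c f x : lin_ext (fun k => c *: f k) x = c *: lin_ext f x.
Proof.
by rewrite scaler_sumr; apply: eq_bigr => k _; rewrite !scalerA mulrC.
Qed.

End LinearExtension.


Lemma malgZU (K : choiceType) (R : comNzRingType) c (k : K) :
  c *: << k >> = << c *g k >> :> {malg R[K]}.
Proof. by apply/malgP => j; rewrite mcoeffZ !mcoeffU mulr_natr. Qed.

Lemma malgMU (M : monomType) (R : comNzRingType) (k j : M) :
  << k >> * << j >> = << mmul k j >> :> {malg R[M]}.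
Proof. by rewrite malgM_def fgmulUU mulr1. Qed.

Lemma malg_scalerAr (M : monomType) (R : comNzRingType) c (x y : {malg R[M]}) :
  x * (c *: y) = c *: (x * y).
Proof.
elim/malg_ind: x => [|x z IHx IHz|d x IH|k].
- by rewrite !mul0r scaler0.
- by rewrite !mulrDl scalerDr IHx IHz.
- by rewrite -!scalerAl IH !scalerA mulrC.
elim/malg_ind: y c => [|x z IHx IHz|d x IH|j] c.
- by rewrite scaler0 mulr0 scaler0.
- by rewrite scalerDr !mulrDr scalerDr IHx IHz.
- by rewrite scalerA !IH scalerA.
by rewrite malgMU !malgZU malgM_def fgmulUU mul1r.
Qed.

(** Identities between products in two different algebras are proved by
    reduction to basis elements with this lemma, one variable at a time. *)
Lemma malg_linear_eq (K : choiceType) (R : comNzRingType) (V : lmodType R)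
    (f g : {malg R[K]} -> V) :
  linear f -> linear g -> (forall k, f << k >> = g << k >>) -> f =1 g.
Proof.
have sumE h : linear h -> forall x : {malg R[K]},
    h x = \sum_(k <- msupp x) x@_k *: (h << k >> : V).
  move=> lh x; pose m := GRing.isLinear.Build R _ V *:%R h lh.
  pose H : {linear {malg R[K]} -> V} := HB.pack h m.
  rewrite -[h]/(H : _ -> _) {1}[x]malgEZ linear_sum.
  by apply: eq_bigr => k _; rewrite linearZ.
move=> lf lg fg x; rewrite (sumE _ lf) (sumE _ lg).
by apply: eq_bigr => k _; rewrite fg.
Qed.

Lemma linear_comp (R : nzRingType) (U V W : lmodType R)
    (f : V -> W) (g : U -> V) :
  linear f -> linear g -> linear (fun x => f (g x)).
Proof. by move=> lf lg c x y; rewrite lg lf. Qed.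

Lemma malg_mul_linearl (M : monomType) (R : comNzRingType) (y : {malg R[M]}) :
  linear (fun x => x * y).
Proof. by move=> c x x'; rewrite mulrDl scalerAl. Qed.

Lemma malg_mul_linearr (M : monomType) (R : comNzRingType) (x : {malg R[M]}) :
  linear (fun y => x * y).
Proof. by move=> c y y'; rewrite mulrDr malg_scalerAr. Qed.

(** The product of two monoids makes the tensor square of a monoid algebra,
    on the basis of pairs, a monoid algebra again, hence a ring. *)
Section PairMonomial.
Variables M N : monomType.
Implicit Types p q r : (M * N)%type.

Definition pair_mul p q : M * N := (mmul p.1 q.1, mmul p.2 q.2).

Fact pair_mulA : associative pair_mul.
Proof. by move=> p q r; rewrite /pair_mul /= !mulmA. Qed.

Fact pair_mul1p : left_id (mone, mone) pair_mul.
Proof. by case=> m n; rewrite /pair_mul /= !mul1m. Qed.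

Fact pair_mulp1 : right_id (mone, mone) pair_mul.
Proof. by case=> m n; rewrite /pair_mul /= !mulm1. Qed.

Fact pair_unitm p q :
  pair_mul p q = (mone, mone) -> p = (mone, mone) /\ q = (mone, mone).
Proof. by case: p q => [a b] [c d] [/unitm[-> ->] /unitm[-> ->]]. Qed.

HB.instance Definition _ := Choice_isMonomialDef.Build (M * N)%type
  pair_mulA pair_mul1p pair_mulp1 pair_unitm.

End PairMonomial.

Lemma tensorE x y :
  tensor x y = lin_ext (fun A => lin_ext (fun B => << (A, B) >>) y) x.
Proof.
apply: eq_bigr => A _; rewrite scaler_sumr; apply: eq_bigr => B _.
by rewrite scalerA.
Qed.

Lemma tensorDl x x' y : tensor (x + x') y = tensor x y + tensor x' y.
Proof. by rewrite !tensorE linearD. Qed.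

Lemma tensorZl c x y : tensor (c *: x) y = c *: tensor x y.
Proof. by rewrite !tensorE linearZ. Qed.

Lemma tensor0l y : tensor 0 y = 0.
Proof. by rewrite tensorE linear0. Qed.

Lemma tensorDr x y y' : tensor x (y + y') = tensor x y + tensor x y'.
Proof.
by rewrite !tensorE -lin_extDf; apply: eq_lin_ext => A; rewrite linearD.
Qed.

Lemma tensorZr c x y : tensor x (c *: y) = c *: tensor x y.
Proof.
by rewrite !tensorE -lin_extZf; apply: eq_lin_ext => A; rewrite linearZ.
Qed.

Lemma tensor0r x : tensor x 0 = 0.
Proof. by rewrite -(scale0r (0 : NCSym)) tensorZr scale0r. Qed.

Lemma tensorU A B : tensor << A >> << B >> = << (A, B) >>.
Proof. by rewrite tensorE !lin_extU. Qed.

Lemma tensor11 : tensor 1 1 = 1.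
Proof. exact: tensorU. Qed.

Lemma tensor_linearl y : linear (tensor^~ y).
Proof. by move=> c x x'; rewrite tensorDl tensorZl. Qed.

Lemma tensor_linearr x : linear (tensor x).
Proof. by move=> c y y'; rewrite tensorDr tensorZr. Qed.

Lemma tensorM x y u v : tensor x y * tensor u v = tensor (x * u) (y * v).
Proof.
have ll y0 t : linear (fun z => tensor z y0 * t).
  exact: linear_comp (malg_mul_linearl t) (tensor_linearl y0).
have lr x0 t : linear (fun z => tensor x0 z * t).
  exact: linear_comp (malg_mul_linearl t) (tensor_linearr x0).
have rl t y0 : linear (fun z => t * tensor z y0).
  exact: linear_comp (malg_mul_linearr t) (tensor_linearl y0).
have rr t x0 : linear (fun z => t * tensor x0 z).
  exact: linear_comp (malg_mul_linearr t) (tensor_linearr x0).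
have Ll u0 t : linear (fun z => tensor (z * u0) t).
  exact: linear_comp (tensor_linearl t) (malg_mul_linearl u0).
have Lr t v0 : linear (fun z => tensor t (z * v0)).
  exact: linear_comp (tensor_linearr t) (malg_mul_linearl v0).
have Rl x0 t : linear (fun z => tensor (x0 * z) t).
  exact: linear_comp (tensor_linearl t) (malg_mul_linearr x0).
have Rr t y0 : linear (fun z => tensor t (y0 * z)).
  exact: linear_comp (tensor_linearr t) (malg_mul_linearr y0).
move: x; apply: malg_linear_eq => // A.
move: y; apply: malg_linear_eq => // B.
move: u; apply: malg_linear_eq => // C.
move: v; apply: malg_linear_eq => // D.
rewrite !tensorU; apply: etrans (malgMU _ _ _) _; apply: esym.
by apply: etrans (tensorU _ _); congr tensor; apply: malgMU.
Qed.

Lemma coproductE x : coproduct x = lin_ext coproduct_basis x.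
Proof. by []. Qed.

Lemma coproductD x y : coproduct (x + y) = coproduct x + coproduct y.
Proof. by rewrite !coproductE linearD. Qed.

Lemma coproductZ c x : coproduct (c *: x) = c *: coproduct x.
Proof. by rewrite !coproductE linearZ. Qed.

Lemma coproduct0 : coproduct 0 = 0.
Proof. by rewrite coproductE linear0. Qed.

Lemma coproductU A : coproduct << A >> = coproduct_basis A.
Proof. by rewrite coproductE lin_extU. Qed.

(** * Standardization and sums over subfamilies *)

Section Standardization.
Local Open Scope fset_scope.

Lemma rank_in_image (f : nat -> nat) (X : {fset nat}) x :
  {in X &, {mono f : y z / (y <= z)%N}} -> x \in X ->
  rank_in [fset f y | y in X] (f x) = rank_in X x.
Proof.
move=> fm xX; have fI := incn_inj_in fm; rewrite /rank_in.
have -> : [fset y in [fset f y | y in X] | (y <= f x)%N] =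
          [fset f y | y in [fset y in X | (y <= x)%N]].
  apply/fsetP => z; rewrite !inE /=; apply/andP/imfsetP => /= -[].
    move=> /imfsetP[y /= yX ->]; rewrite fm // => yx.
    by exists y => //; rewrite !inE yX.
  move=> y; rewrite !inE => /andP[yX yx] ->.
  by rewrite fm // in_imfset.
rewrite card_in_imfset // => y z; rewrite !inE => /andP[yX _] /andP[zX _].
exact: fI.
Qed.

Lemma rank_in_interval n x : x \in interval_1 n -> rank_in (interval_1 n) x = x.
Proof.
rewrite in_interval_1 => /andP[x0 xn]; rewrite /rank_in.
rewrite -[RHS]card_interval_1; congr #|` _|; apply/fsetP => y.
rewrite !inE /= !mem_iota !add1n !ltnS; case: (ltnP 0 y) => //= y0.
by case: (leqP y x) => yx; rewrite ?andbF // (leq_trans yx).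
Qed.

Lemma rank_inUl (X Y : {fset nat}) x :
  {in X & Y, forall y z, (y < z)%N} -> x \in X ->
  rank_in (X `|` Y) x = rank_in X x.
Proof.
move=> XY xX; congr #|` _|; apply/fsetP => y; rewrite !inE /=.
case: (boolP (y \in Y)) => yY; last by rewrite orbF.
rewrite orbT andTb -[RHS]/((y \in X) && (y <= x)%N).
have yx : (y <= x)%N = false by apply/negbTE; rewrite -ltnNge XY.
by rewrite yx andbF.
Qed.

Lemma rank_inUr (X Y : {fset nat}) x :
  {in X & Y, forall y z, (y < z)%N} -> x \in Y ->
  rank_in (X `|` Y) x = (#|` X| + rank_in Y x)%N.
Proof.
move=> XY xY; rewrite /rank_in.
have -> : [fset y in (X `|` Y) | (y <= x)%N] =
          (X `|` [fset y in Y | (y <= x)%N]).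
  apply/fsetP => y; rewrite !inE /=.
  case: (boolP (y \in X)) => yX //=.
  by rewrite ltnW ?XY.
rewrite cardfsU (_ : X `&` _ = fset0) ?cardfs0 ?subn0 //.
apply/fsetP => y; rewrite !inE /=; apply/negP => /and3P[yX yY _].
by have := XY y y yX yY; rewrite ltnn.
Qed.

Lemma eq_in_image_family f g (A : set_family) :
  {in fcover A, f =1 g} -> image_family f A = image_family g A.
Proof.
move=> fg.
have e (a : {fset nat}) : a \in A -> [fset f x | x in a] = [fset g x | x in a].
  move=> aA; apply: eq_in_imfset => // x xa.
  by apply: fg; apply/fcoverP; exists a.
by apply/fsetP => y; apply/image_familyP/image_familyP => -[a aA ->];
  exists a; rewrite // e.
Qed.

Lemma standardize_image (f : nat -> nat) (A : set_family) :
  {in fcover A &, {mono f : x y / (x <= y)%N}} ->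
  standardize (image_family f A) = standardize A.
Proof.
move=> fm; rewrite /standardize image_family_comp fcover_image.
by apply: eq_in_image_family => x xA; rewrite /= rank_in_image.
Qed.

Lemma degree_standardize (A : set_family) : degree (standardize A) = degree A.
Proof. by rewrite /degree fcover_image rank_image card_interval_1. Qed.

(** In the union, an element of the lower family keeps its rank, and the size
    of the lower union is added to the rank of an element of the upper one. *)
Lemma standardizeU (A B : set_family) :
  {in fcover A & fcover B, forall x y, (x < y)%N} ->
  standardize (A `|` B) = slash (standardize A) (standardize B).
Proof.
move=> AB; rewrite /standardize /slash fcoverU image_familyU; congr (_ `|` _).
  by apply: eq_in_image_family => x xA; rewrite rank_inUl.
rewrite image_family_comp; apply: eq_in_image_family => x xB /=.
by rewrite rank_inUr // -/(standardize A) degree_standardize.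
Qed.

(** Total, so that no proof that [B] partitions its union is carried around;
    it is meaningful only for such [B]. *)
Definition std (B : set_family) : setpart := insubd emptyp (standardize B).

Lemma val_std (B : set_family) :
  partition_of (fcover B) B -> std B = standardize B :> set_family.
Proof. by move=> pB; rewrite [LHS]insubdK //; apply: standardize_setpart. Qed.

Lemma setpart_cover (A : setpart) : fcover A = interval_1 (degree A).
Proof. by have /partition_ofP[] := setpartP A. Qed.

Lemma setpart_partition (A : setpart) : partition_of (fcover A) A.
Proof. by rewrite setpart_cover setpartP. Qed.

Lemma std_setpart (A : setpart) : std A = A.
Proof.
apply: val_inj; rewrite /= val_std ?setpart_partition //.
rewrite -[RHS]image_family_id; apply: eq_in_image_family => x.
by rewrite setpart_cover => /rank_in_interval.
Qed.

Lemma std_image (f : nat -> nat) (A : set_family) :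
  {in fcover A &, {mono f : x y / (x <= y)%N}} ->
  std (image_family f A) = std A.
Proof. by move=> fm; rewrite /std standardize_image. Qed.

Lemma partition_ofU (A B : set_family) :
  partition_of (fcover A) A -> partition_of (fcover B) B ->
  {in fcover A & fcover B, forall x y, (x < y)%N} ->
  partition_of (fcover (A `|` B)) (A `|` B).
Proof.
move=> pA pB AB; apply/partition_ofP.
have [A0 tA _] := partition_ofP _ _ pA; have [B0 tB _] := partition_ofP _ _ pB.
have dis a b x : a \in A -> b \in B -> x \in a -> x \in b -> False.
  move=> aA bB xa xb; have : (x < x)%N; last by rewrite ltnn.
  by apply: AB; apply/fcoverP; [exists a|exists b].
split=> //; first by rewrite inE negb_or A0.
move=> a b x; rewrite !inE => /orP[] aA /orP[] bA xa xb.
- exact: (tA _ _ x).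
- by case: (dis _ _ _ aA bA xa xb).
- by case: (dis _ _ _ bA aA xb xa).
- exact: (tB _ _ x).
Qed.

Lemma stdU (A B : set_family) :
  partition_of (fcover A) A -> partition_of (fcover B) B ->
  {in fcover A & fcover B, forall x y, (x < y)%N} ->
  std (A `|` B) = bar (std A) (std B).
Proof.
move=> pA pB AB; apply: val_inj => /=.
by rewrite !val_std ?partition_ofU // standardizeU.
Qed.

Lemma std0 : std fset0 = emptyp.
Proof. exact: (std_setpart emptyp). Qed.

Lemma card_standardize (B : set_family) :
  partition_of (fcover B) B -> #|` standardize B| = #|` B|.
Proof.
move=> /partition_ofP[B0 tB _]; apply: card_in_imfset => a b aB bB /= e.
have [x xa] : exists x, x \in a.
  by apply/fset0Pn; apply: contraNneq B0 => <-.
have : rank_in (fcover B) x \in [fset rank_in (fcover B) y | y in b].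
  by rewrite -e in_imfset.
move=> /imfsetP[y /= yb /rank_inj xy].
suff xEy : x = y by apply: (tB a b x) => //; rewrite xEy.
by apply: xy; apply/fcoverP; [exists a|exists b].
Qed.

End Standardization.

Section Subparts.
Local Open Scope fset_scope.
Variable A : set_family.
Let part (k : 'I_(nparts A)) := nth fset0 (ordered_parts A) k.

Lemma part_inj : injective part.
Proof.
move=> i j /eqP; rewrite nth_uniq ?size_sort //; first by move/eqP/val_inj.
by rewrite sort_uniq fset_uniq.
Qed.

Lemma mem_subparts (K : {set 'I_(nparts A)}) k :
  (part k \in subparts K) = (k \in K).
Proof. by rewrite (mem_imfset _ _ part_inj). Qed.

Lemma part_onto a : a \in A -> exists k, a = part k.
Proof.
rewrite -(mem_sort (fun b c : {fset nat} => (min_elt b <= min_elt c)%N)).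
move=> aA; have := aA; rewrite -index_mem size_sort => lt.
by exists (Ordinal lt); rewrite /part /= nth_index.
Qed.

Lemma mem_part k : part k \in A.
Proof.
have: part k \in ordered_parts A by rewrite mem_nth // size_sort.
by rewrite mem_sort.
Qed.

Lemma subpartsT : subparts [set: 'I_(nparts A)] = A.
Proof.
apply/fsetP => a; apply/idP/idP => [/(fsubsetP (subparts_sub _))//|].
by move=> /part_onto[k ->]; rewrite mem_subparts inE.
Qed.

Lemma subpartsC (K : {set 'I_(nparts A)}) : subparts (~: K) = A `\` subparts K.
Proof.
apply/fsetP => a; rewrite inE; apply/idP/andP => [|[aK /part_onto[k]]].
  move=> aK; have := fsubsetP (subparts_sub _) _ aK => aA; split=> //.
  have [k ak] := part_onto aA; move: aK.
  by rewrite ak !mem_subparts inE.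
by move=> ak; move: aK; rewrite ak !mem_subparts inE.
Qed.

Lemma card_subparts (K : {set 'I_(nparts A)}) : #|` subparts K| = #|K|.
Proof. by rewrite card_imfset /=; [rewrite cardE|apply: part_inj]. Qed.

Lemma subparts0 : subparts (set0 : {set 'I_(nparts A)}) = fset0.
Proof. by apply/eqP; rewrite -cardfs_eq0 card_subparts cards0. Qed.

Lemma subpartsD (K X : {set 'I_(nparts A)}) :
  subparts (K :\: X) = subparts K `\` subparts X.
Proof.
apply/fsetP => a; rewrite inE; case: (boolP (a \in A)) => [|aA].
  by move=> /part_onto[k ->]; rewrite !mem_subparts inE.
by rewrite !(contraNF (fsubsetP (subparts_sub _) a) aA) andbF.
Qed.

End Subparts.

Lemma std_subpartsE (A : setpart) (K : {set 'I_(nparts A)}) :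
  std_subparts K = std (subparts K).
Proof.
apply: val_inj; rewrite /= val_std //.
exact: partition_sub (subparts_sub _) (setpartP A).
Qed.

Section SubfamilySums.
Local Open Scope fset_scope.
Variable V : nmodType.

Lemma big_fpowerset_set (I : finType) (T : choiceType) (t : I -> T)
    (K : {set I}) (G : {fset T} -> V) :
  injective t ->
  \sum_(C <- fpowerset [fset t i | i in K]) G C =
  \sum_(X : {set I} | X \subset K) G [fset t i | i in X].
Proof.
move=> tI; have mem (X : {set I}) i : (t i \in [fset t j | j in X]) = (i \in X).
  by rewrite mem_imfset.
pose im (X : {set I}) := [fset t i | i in X].
have pm : perm_eq (fpowerset [fset t i | i in K])
    [seq im X | X : {set I} <- index_enum {set I} & X \subset K].
  apply: uniq_perm => [||C]; first exact: fset_uniq.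
    rewrite map_inj_uniq ?filter_uniq ?index_enum_uniq //.
    by move=> X Y e; apply/setP => i; rewrite -!mem -!/(im _) e.
  rewrite fpowersetE; apply/fsubsetP/mapP => [sub|[X]].
    exists [set i | t i \in C].
      rewrite mem_filter mem_index_enum andbT; apply/subsetP => i.
      by rewrite inE => /sub; rewrite mem.
    apply/fsetP => x; apply/idP/imfsetP => /= [xC|[i]].
      by have /imfsetP[i /= _ e] := sub _ xC; exists i; rewrite // inE -e.
    by rewrite inE => iC ->.
  rewrite mem_filter => /andP[/subsetP XK _] -> x /imfsetP[i /= iX ->].
  by rewrite mem XK.
by rewrite (perm_big _ pm) big_map big_filter.
Qed.

Lemma big_fpowersetU (T : choiceType) (A B : {fset T}) (G : {fset T} -> V) :
  [disjoint A & B] ->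
  \sum_(C <- fpowerset (A `|` B)) G C =
  \sum_(C <- fpowerset A) \sum_(D <- fpowerset B) G (C `|` D).
Proof.
move=> AB; have pm : perm_eq (fpowerset (A `|` B))
    [seq C `|` D | C <- fpowerset A, D <- fpowerset B].
  apply: uniq_perm => [||C]; first exact: fset_uniq.
    apply: allpairs_uniq; rewrite ?fset_uniq // => -[C D] [C' D'] /=.
    move=> /allpairsP[[E F] /= [sE sF [-> ->]]].
    move=> /allpairsP[[E' F'] /= [sE' sF' [-> ->]]].
    rewrite !fpowersetE in sE sF sE' sF'.
    have key E1 F1 : E1 `<=` A -> F1 `<=` B ->
        (E1 `|` F1) `&` A = E1 /\ (E1 `|` F1) `&` B = F1.
      move=> /fsubsetP E1A /fsubsetP F1B; split; apply/fsetP => x; rewrite !inE.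
        case: (boolP (x \in E1)) => [/E1A ->|_] //=.
        apply/negP => /andP[/F1B xB xA].
        by have := fdisjointP AB _ xA; rewrite xB.
      case: (boolP (x \in F1)) => [/F1B ->|_] //=; first by rewrite orbT.
      rewrite orbF; apply/negP => /andP[/E1A xA xB].
      by have := fdisjointP AB _ xA; rewrite xB.
    have [e1 e2] := key _ _ sE sF; have [e1' e2'] := key _ _ sE' sF'.
    by move=> e; move: e1 e2; rewrite e e1' e2' => -> ->.
  rewrite fpowersetE; apply/idP/allpairsP => [sub|[[E F] /= [sE sF ->]]].
    exists (C `&` A, C `&` B); rewrite !fpowersetE !fsubsetIr; split=> //=.
    by rewrite -fsetIUr; apply/esym/fsetIidPl.
  by rewrite !fpowersetE in sE sF; apply: fsetUSS.
by rewrite (perm_big _ pm) big_allpairs_dep.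
Qed.

Lemma big_fpowerset_image (T U : choiceType) (g : T -> U) (A : {fset T})
    (G : {fset U} -> V) :
  {in A &, injective g} ->
  \sum_(C <- fpowerset [fset g a | a in A]) G C =
  \sum_(C <- fpowerset A) G [fset g a | a in C].
Proof.
move=> gI; pose im (C : {fset T}) := [fset g a | a in C].
have pm : perm_eq (fpowerset (im A)) [seq im C | C <- fpowerset A].
  apply: uniq_perm => [||C]; first exact: fset_uniq.
    rewrite map_inj_in_uniq ?fset_uniq // => C D.
    rewrite !fpowersetE => /fsubsetP CA /fsubsetP DA e.
    have mem (E : {fset T}) a : {subset E <= A} -> a \in A ->
        (g a \in im E) = (a \in E).
      move=> EA aA; apply/imfsetP/idP => /= [[b bE /gI ->]|aE] //;
        last by exists a.
      exact: EA.
    apply/fsetP => a; case: (boolP (a \in A)) => [aA|aA].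
      by rewrite -(mem C) // -(mem D) // e.
    by rewrite (contraNF (CA a) aA) (contraNF (DA a) aA).
  rewrite fpowersetE; apply/fsubsetP/mapP => [sub|[D]].
    exists [fset a in A | g a \in C].
      by rewrite fpowersetE; apply/fsubsetP => a; rewrite !inE => /andP[].
    apply/fsetP => x; apply/idP/imfsetP => /= [xC|[a]].
      have /imfsetP[a /= aA e] := sub _ xC; exists a => //.
      by rewrite !inE -e aA.
    by rewrite !inE => /andP[_ aC] ->.
  rewrite fpowersetE => /fsubsetP DA -> x /imfsetP[a /= /DA aA ->].
  exact: in_imfset.
by rewrite (perm_big _ pm) big_map.
Qed.

End SubfamilySums.

(** * The coproduct is multiplicative *)

Section CoproductOfSubfamilies.
Local Open Scope fset_scope.

Lemma rank_in_mono (X : {fset nat}) :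
  {in X &, {mono rank_in X : x y / (x <= y)%N}}.
Proof.
have le x y : (x <= y)%N -> (rank_in X x <= rank_in X y)%N.
  move=> xy; apply: fsubset_leq_card; apply/fsubsetP => z.
  by rewrite !inE /= => /andP[-> /leq_trans->].
move=> x y xX yX; case: (leqP x y) => [/le //|yx].
apply/negbTE; rewrite -ltnNge ltn_neqAle le 1?ltnW // andbT.
by apply: contraTneq yx => /(rank_inj yX xX) ->; rewrite ltnn.
Qed.

Lemma image_fset_inj (f : nat -> nat) (A : set_family) :
  {in fcover A &, injective f} ->
  {in A &, injective (fun a : {fset nat} => [fset f x | x in a])}.
Proof.
move=> fI a b aA bA e; have sub c d : c \in A -> d \in A ->
    [fset f x | x in c] = [fset f x | x in d] -> {subset c <= d}.
  move=> cA dA cd x xc; have : f x \in [fset f x | x in d].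
    by rewrite -cd in_imfset.
  move=> /imfsetP[y /= yd /fI -> //]; apply/fcoverP; first by exists c.
  by exists d.
by apply/fsetP => x; apply/idP/idP; apply: sub.
Qed.

Lemma image_familyD (f : nat -> nat) (A B : set_family) :
  {in fcover A &, injective f} -> B `<=` A ->
  image_family f (A `\` B) = image_family f A `\` image_family f B.
Proof.
move=> /image_fset_inj fI /fsubsetP BA; apply/fsetP => y; rewrite inE.
apply/image_familyP/andP => [[a]|[/negP nB /image_familyP[a aA e]]].
  rewrite inE => /andP[aB aA] ->; split; last first.
    by apply/image_familyP; exists a.
  by apply: contra aB => /image_familyP[b bB /fI ->] //; apply: BA.
exists a => //; rewrite inE aA andbT; apply/negP => aB; apply: nB.
by apply/image_familyP; exists a.
Qed.

Lemma fcover_sub (A B : set_family) : B `<=` A -> {subset fcover B <= fcover A}.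
Proof.
move=> /fsubsetP BA x /fcoverP[b bB xb]; apply/fcoverP; exists b => //.
exact: BA.
Qed.

(** The second component of a pair must be the complement of the first. *)
Lemma coproduct_setpart (A : setpart) :
  coproduct << A >> =
  \sum_(C <- fpowerset A) << (std C, std (A `\` C)) >>.
Proof.
rewrite coproductU /coproduct_basis.
rewrite (reindex_onto (fun K => (K, ~: K)) fst) /=; last first.
  move=> [K L] /= /andP[/eqP KL /eqP KL0]; congr (_, _); apply/setP => k.
  move/setP/(_ k): KL; move/setP/(_ k): KL0; rewrite !inE.
  by case: (k \in K).
transitivity (\sum_(K : {set 'I_(nparts A)} | K \subset setT)
    << (std_subparts K, std_subparts (~: K)) >> : NCSym2).
  by apply: eq_bigl => K; rewrite setUCr setICr !eqxx subsetT.
have <- : \sum_(C <- fpowerset (subparts [set: 'I_(nparts A)]))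
    << (std C, std (A `\` C)) >> = \sum_(C <- fpowerset A)
    << (std C, std (A `\` C)) >> :> NCSym2 by rewrite subpartsT.
rewrite (big_fpowerset_set _ _ (@part_inj A)); apply: eq_bigr => K _.
by rewrite !std_subpartsE subpartsC.
Qed.

(** Standardizing relabels by an increasing map, which changes neither the
    subfamilies nor their standardizations. *)
Lemma coproduct_std (B : set_family) :
  partition_of (fcover B) B ->
  coproduct << std B >> = \sum_(C <- fpowerset B) << (std C, std (B `\` C)) >>.
Proof.
move=> pB; rewrite coproduct_setpart (val_std pB).
have fI := @rank_inj (fcover B).
rewrite /standardize [X in fpowerset X]/image_family.
rewrite (big_fpowerset_image _ (image_fset_inj fI)).
apply: eq_big_seq => C.
rewrite fpowersetE => CB; rewrite -/(image_family _ C) -(image_familyD fI CB).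
have mono D : D `<=` B ->
    {in fcover D &, {mono rank_in (fcover B) : x y / (x <= y)%N}}.
  by move=> /fcover_sub DB x y /DB xB /DB yB; apply: rank_in_mono.
by rewrite (std_image (mono _ CB)) (std_image (mono _ (fsubsetDl _ _))).
Qed.

(** A subfamily of [bar A B] is a subfamily of [A] together with a shifted
    subfamily of [B], and both pieces of a cut standardize to such a product. *)
Lemma coproductMU (A B : setpart) :
  coproduct << bar A B >> = coproduct << A >> * coproduct << B >>.
Proof.
rewrite -[bar A B]std_setpart (coproduct_std (setpart_partition _)) /=.
rewrite /slash; set im := image_family _.
have AB : {in fcover A & fcover (im B), forall x y, (x < y)%N}.
  move=> x y; rewrite fcover_image !setpart_cover in_interval_1 => /andP[_ xA].
  by rewrite shiftP => /andP[/(leq_ltn_trans xA)].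
have [A0 _ _] := partition_ofP _ _ (setpartP A).
have dAB : [disjoint (A : set_family) & im B].
  apply/fdisjointP => a aA; apply/negP => aB.
  have [x xa] : exists x, x \in a by apply/fset0Pn; apply: contraNneq A0 => <-.
  have : (x < x)%N; last by rewrite ltnn.
  by apply: AB; apply/fcoverP; exists a.
rewrite (big_fpowersetU _ dAB) !coproduct_setpart mulr_suml.
apply: eq_big_seq => C; rewrite fpowersetE => CA.
have addI : {in fcover B &, injective (addn (degree A))}.
  by move=> x y _ _; apply: addnI.
rewrite mulr_sumr {1}/im {1}/image_family.
rewrite (big_fpowerset_image _ (image_fset_inj addI)).
apply: eq_big_seq => D; rewrite fpowersetE => DB; rewrite -/(im D).
have stdE C' D' : C' `<=` A -> D' `<=` B ->
    std (C' `|` im D') = bar (std C') (std D').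
  move=> CA' DB'; rewrite stdU.
  - by congr bar; apply: std_image => x y _ _; rewrite leq_add2l.
  - exact: partition_sub CA' (setpartP A).
  - rewrite fcover_image; apply: partition_image => [x y _ _|];
      first exact: addnI.
    exact: partition_sub DB' (setpartP B).
  - move=> x y /(fcover_sub CA') xA yD; apply: AB => //; move: yD.
    rewrite !fcover_image => /imfsetP[z /= /(fcover_sub DB') zB ->].
    by rewrite in_imfset.
have -> : (A `|` im B) `\` (C `|` im D) = (A `\` C) `|` im (B `\` D).
  rewrite /im (image_familyD addI DB) -/(im B) -/(im D).
  apply/fsetP => a; rewrite !inE.
  have nAB : a \in (A : set_family) -> a \notin im B by move/(fdisjointP dAB).
  have nD : a \in im D -> a \in im B.
    case/image_familyP => b bD ->; apply/image_familyP; exists b => //.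
    exact: fsubsetP DB _ bD.
  have nC : a \in C -> a \in (A : set_family) := fsubsetP CA a.
  move: nAB nD nC; case: (a \in (A : set_family)); case: (a \in im B);
    case: (a \in C); case: (a \in im D) => //= h1 h2 h3;
    do ?[by have := h1 isT];
    do ?[by have := h2 isT]; by have := h3 isT.
rewrite (stdE _ _ CA DB) (stdE _ _ (fsubsetDl _ _) (fsubsetDl _ _)).
by apply: esym; apply: malgMU.
Qed.

End CoproductOfSubfamilies.

Lemma coproductM x y : coproduct (x * y) = coproduct x * coproduct y.
Proof.
have lc : linear coproduct by move=> c z t; rewrite coproductD coproductZ.
move: x; apply: malg_linear_eq => [||A].
- exact: linear_comp lc (malg_mul_linearl y).
- exact: linear_comp (malg_mul_linearl _) lc.
move: y; apply: malg_linear_eq => [||B].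
- exact: linear_comp lc (malg_mul_linearr _).
- exact: linear_comp (malg_mul_linearr _) lc.
by rewrite malgMU; apply: coproductMU.
Qed.

(** * Primitivity from a recursion, and set compositions *)

(** The terms of the coproduct of a product of primitive elements: each letter
    goes to the left or to the right factor. *)
Fixpoint splits (I : Type) (w : seq I) : seq (seq I * seq I) :=
  if w is a :: w' then
    [seq (a :: ut.1, ut.2) | ut <- splits w'] ++
    [seq (ut.1, a :: ut.2) | ut <- splits w']
  else [:: ([::], [::])].

(** What primitivity arguments use of the coproduct [Delta] and of the tensor
    map [tau], for arbitrary rings in place of the algebra and its square. *)
Section CoproductAxioms.
Variables (U W : nzRingType) (Delta : U -> W) (tau : U -> U -> W).
Hypothesis DeltaD : {morph Delta : x y / x + y}.
Hypothesis DeltaM : {morph Delta : x y / x * y}.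
Hypothesis tauDl : forall y, {morph tau^~ y : x x' / x + x'}.
Hypothesis tauDr : forall x, {morph tau x : y y' / y + y'}.
Hypothesis tauM : forall x y u v, tau x y * tau u v = tau (x * u) (y * v).
Hypothesis tau11 : tau 1 1 = 1.
Let zero_of_morph (A B : zmodType) (f : A -> B) :
  {morph f : x y / x + y} -> f 0 = 0.
Proof. by move=> fD; apply: (@addrI _ (f 0)); rewrite -fD !addr0. Qed.

Let Delta_sum I (r : seq I) P F :
  Delta (\sum_(i <- r | P i) F i) = \sum_(i <- r | P i) Delta (F i).
Proof. exact: (big_morph _ DeltaD (zero_of_morph DeltaD)). Qed.

Let tau_suml I (r : seq I) P F y :
  tau (\sum_(i <- r | P i) F i) y = \sum_(i <- r | P i) tau (F i) y.
Proof.
exact: (big_morph (tau^~ y) (tauDl y) (zero_of_morph (tauDl y))).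
Qed.

Let tau_sumr I (r : seq I) P x F :
  tau x (\sum_(i <- r | P i) F i) = \sum_(i <- r | P i) tau x (F i).
Proof. exact: (big_morph _ (tauDr x) (zero_of_morph (tauDr x))). Qed.

(** The mixed terms [tau x y + tau y x] of the coproduct of [x * y] are
    symmetric in [x] and [y]. *)
Lemma bracket_primitive x y :
  Delta x = tau x 1 + tau 1 x -> Delta y = tau y 1 + tau 1 y ->
  Delta (x * y - y * x) = tau (x * y - y * x) 1 + tau 1 (x * y - y * x).
Proof.
have mulE s t : Delta s = tau s 1 + tau 1 s -> Delta t = tau t 1 + tau 1 t ->
    Delta (s * t) = tau (s * t) 1 + tau 1 (s * t) + (tau s t + tau t s).
  move=> ds dt; rewrite DeltaM ds dt mulrDl !mulrDr !tauM !mulr1 !mul1r.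
  by rewrite [tau t s + _]addrC addrACA.
move=> dx dy; apply: (@addIr _ (Delta (y * x))); rewrite -DeltaD subrK.
rewrite (mulE x y) // (mulE y x) // [tau y x + tau x y]addrC [RHS]addrA.
by congr (_ + _); rewrite [RHS]addrACA -tauDl -tauDr subrK.
Qed.

Lemma coproduct_word (I : Type) (v : I -> U) (w : seq I) :
  (forall i, Delta (v i) = tau (v i) 1 + tau 1 (v i)) -> Delta 1 = 1 ->
  Delta (\prod_(i <- w) v i) =
  \sum_(ut <- splits w) tau (\prod_(i <- ut.1) v i) (\prod_(i <- ut.2) v i).
Proof.
move=> vP Delta1; elim: w => [|a w IH].
  by rewrite big_seq1 !big_nil tau11.
rewrite big_cons DeltaM vP IH /= big_cat !big_map mulrDl !mulr_sumr.
by congr (_ + _); apply: eq_bigr => -[u t] _; rewrite tauM !mul1r big_cons.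
Qed.

Section Recursion.
Variables (T : finType) (k0 : T) (c p : {set T} -> U).
Hypothesis c0 : c set0 = 1.
Hypothesis Delta_c : forall K : {set T},
  Delta (c K) = \sum_(X : {set T} | X \subset K) tau (c X) (c (K :\: X)).
Hypothesis c_rec : forall K : {set T}, k0 \in K ->
  c K = \sum_(J : {set T} | (J \subset K) && (k0 \in J)) p J * c (K :\: J).

Let big_complement (K : {set T}) (Q : pred {set T}) (F : {set T} -> W) :
  \sum_(Z : {set T} | (Z \subset K) && Q Z) F Z =
  \sum_(Z : {set T} | (Z \subset K) && Q (K :\: Z)) F (K :\: Z).
Proof.
have KK (Z : {set T}) : Z \subset K -> K :\: (K :\: Z) = Z.
  by move=> ZK; rewrite setDDr setDv set0U; apply/setIidPr.
rewrite (reindex_onto (fun Z => K :\: Z) (fun Z => K :\: Z)) /=.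
  apply: eq_bigl => Z; rewrite subsetDl /=.
  apply/andP/andP => [[QZ /eqP e]|[ZK QZ]]; last by rewrite QZ KK.
  by split=> //; rewrite -e subsetDl.
by move=> Z /andP[/KK].
Qed.

Let big_exchange (K : {set T}) (F : {set T} -> {set T} -> W) :
  \sum_(J : {set T} | (J \subset K) && (k0 \in J))
    \sum_(Z : {set T} | Z \subset K :\: J) F J Z =
  \sum_(Z : {set T} | (Z \subset K) && (k0 \notin Z))
    \sum_(J : {set T} | (J \subset K :\: Z) && (k0 \in J)) F J Z.
Proof.
have disC (J Z : {set T}) : [disjoint J & Z] = [disjoint Z & J].
  by rewrite disjoint_sym.
rewrite (exchange_big_dep (fun Z : {set T} => (Z \subset K) && (k0 \notin Z))).
  apply: eq_bigr => Z /andP[ZK Z0]; apply: eq_bigl => J /=.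
  by rewrite !subsetD ZK disC; case: (J \subset K) (k0 \in J) => [] [];
    rewrite //= ?andbF ?andbT.
move=> J Z /andP[JK J0] /=; rewrite subsetD => /andP[-> dZ] /=.
by apply: contraL J0 => /(disjointFr dZ) ->.
Qed.

(** Both halves of the primitive part of [p J], multiplied by the coproduct of
    the complement, resum by [c_rec]: the left half to the terms of
    [Delta (c K)] with [k0] in the left factor, the right half to the others. *)
Lemma coproduct_resum (K : {set T}) : k0 \in K ->
  \sum_(J : {set T} | (J \subset K) && (k0 \in J))
    (tau (p J) 1 + tau 1 (p J)) * Delta (c (K :\: J)) = Delta (c K).
Proof.
move=> K0.
have split_term (J : {set T}) :
    (tau (p J) 1 + tau 1 (p J)) * Delta (c (K :\: J)) =
    \sum_(Z : {set T} | Z \subset K :\: J)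
      tau (p J * c (K :\: J :\: Z)) (c Z) +
    \sum_(Z : {set T} | Z \subset K :\: J)
      tau (c Z) (p J * c (K :\: J :\: Z)).
  rewrite Delta_c mulrDl !mulr_sumr; congr (_ + _); last first.
    by apply: eq_bigr => Z _; rewrite tauM mul1r.
  rewrite (eq_bigl (fun Z : {set T} => (Z \subset K :\: J) && true));
    last first.
    by move=> Z; rewrite andbT.
  rewrite (big_complement (K :\: J) xpredT).
  rewrite (eq_bigl (fun Z : {set T} => Z \subset K :\: J)); last first.
    by move=> Z; rewrite andbT.
  apply: eq_bigr => Z ZK; rewrite tauM mul1r; congr (tau _ (c _)).
  by rewrite setDDr setDv set0U; apply/setIidPr.
rewrite (eq_bigr _ (fun J _ => split_term J)) big_split /= !big_exchange.
rewrite Delta_c [RHS](bigID (fun X : {set T} => k0 \in X)) /=; congr (_ + _).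
  rewrite (big_complement K (fun X => k0 \in X)).
  apply: eq_big => [Z|Z /andP[ZK Z0]]; first by rewrite inE K0 andbT.
  rewrite setDDr setDv set0U (setIidPr ZK) -tau_suml; congr (tau _ _).
  rewrite [RHS]c_rec; last by rewrite inE K0 Z0.
  by apply: eq_bigr => J _; rewrite setDDl setUC -setDDl.
apply: eq_bigr => Z /andP[ZK Z0]; rewrite -tau_sumr; congr (tau _ _).
rewrite [RHS]c_rec; last by rewrite inE K0 Z0.
by apply: eq_bigr => J _; rewrite setDDl setUC -setDDl.
Qed.

(** Subtract [coproduct_resum] from the coproduct of [c_rec]: by induction the
    terms with [J] smaller than [K] agree, and the term [J = K] is the claim. *)
Lemma primitive_of_recursion (K : {set T}) : k0 \in K ->
  Delta (p K) = tau (p K) 1 + tau 1 (p K).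
Proof.
have [n] := ubnP #|K|; elim: n => // n IHn in K *; rewrite ltnS => Kn K0.
have Delta_c0 : Delta (c set0) = 1.
  rewrite Delta_c (big_pred1 set0) => [|X]; last by rewrite subset0.
  by rewrite setD0 c0.
have := coproduct_resum K0; rewrite (c_rec K0) Delta_sum.
rewrite (bigD1 K) ?subxx //= [RHS](bigD1 K) ?subxx //=.
rewrite DeltaM setDv Delta_c0 !mulr1.
rewrite (eq_bigr (fun J => Delta (p J * c (K :\: J)))).
  by move/addIr.
move=> J /andP[/andP[JK J0] neJK]; rewrite DeltaM IHn //.
apply: leq_trans Kn; apply: proper_card.
by rewrite properEneq neJK.
Qed.

End Recursion.
End CoproductAxioms.

Section SetCompositions.
Variable T : finType.
Implicit Types (K L J : {set T}) (g : seq {set T}).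

Lemma setD_proper K L : L != set0 -> L \subset K -> K :\: L \proper K.
Proof.
case/set0Pn=> x xL /subsetP LK; apply/properP; split; first exact: subsetDl.
by exists x; rewrite ?LK // inE xL.
Qed.

Lemma setDK K L : L \subset K -> K :\: (K :\: L) = L.
Proof. by move=> LK; rewrite setDDr setDv set0U; apply/setIidPr. Qed.

Lemma set_composition_rcons K g L :
  set_composition K (rcons g L) =
  [&& L != set0, L \subset K & set_composition (K :\: L) g].
Proof.
have cupE : all [pred B : {set T} | [disjoint B & L]] g =
    [disjoint \bigcup_(B <- g) B & L].
  elim: g => [|B g IH]; first by rewrite big_nil /= -setI_eq0 set0I eqxx.
  rewrite big_cons /= IH -!setI_eq0 setIUl setU_eq0.
  by rewrite setI_eq0.
rewrite /set_composition mem_rcons inE negb_or eq_sym pairwise_rcons cupE.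
rewrite -cats1 big_cat big_seq1; set C := \bigcup_(B <- g) B.
case: (L != set0) => //=; case: (set0 \notin g); rewrite ?andbF //=.
case: (pairwise _ g); rewrite ?andbT ?andbF //= -setI_eq0.
apply/andP/andP => [[/eqP CL /eqP <-]|[LK /eqP ->]].
  rewrite subsetUr setDUl setDv setU0; split=> //.
  by rewrite eq_sym; apply/eqP/setDidPl; rewrite -setI_eq0 CL.
split; first by rewrite setIDAC -setIDA setDv setI0.
apply/eqP/setP => x; rewrite !inE.
case: (boolP (x \in L)) => [/(subsetP LK)->//|_].
by rewrite orbF.
Qed.

Lemma set_composition_nil K : set_composition K [::] = (K == set0).
Proof. by rewrite /set_composition big_nil /= eq_sym. Qed.

Lemma size_set_composition K g : set_composition K g -> (size g <= #|K|)%N.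
Proof.
elim/last_ind: g K => // g L IH K.
rewrite set_composition_rcons size_rcons => /and3P[L0 LK /IH].
move/leq_ltn_trans; apply; apply: proper_card.
exact: setD_proper.
Qed.

Section CompositionSum.
Variables (U : nzRingType) (k0 : T) (c : {set T} -> U).

Definition sign_weight g : U := (-1) ^+ (size g).-1 * \prod_(B <- g) c B.

Definition compositions_from (n : nat) K : seq (seq {set T}) :=
  [seq val g | g : n.-bseq {set T} <- index_enum (n.-bseq {set T}) &
     set_composition K g && (k0 \in head set0 g)].

Definition composition_sum (n : nat) K : U :=
  \sum_(g : n.-bseq {set T} | set_composition K g && (k0 \in head set0 g))
    sign_weight g.

Lemma mem_compositions_from n K g : (#|T| <= n)%N ->
  (g \in compositions_from n K) = set_composition K g && (k0 \in head set0 g).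
Proof.
move=> Tn; apply/mapP/idP => [[h] |Pg].
  by rewrite mem_filter => /andP[Ph _] ->.
have gn : (size g <= n)%N.
  case/andP: Pg => /size_set_composition gK _.
  exact: leq_trans gK (leq_trans (max_card _) Tn).
by exists (Bseq gn); rewrite // mem_filter Pg mem_index_enum.
Qed.

Lemma composition_sumE n K :
  composition_sum n K = \sum_(g <- compositions_from n K) sign_weight g.
Proof. by rewrite big_map big_filter. Qed.

Lemma compositions_from_uniq n K : uniq (compositions_from n K).
Proof.
by rewrite map_inj_uniq ?filter_uniq ?index_enum_uniq //; apply: val_inj.
Qed.

(** The last block of a composition is the complement of the union [J] of the
    others, and [k0] stays in the first block as long as [J] is nonempty. *)
Lemma compositions_from_split n K : (#|T| <= n)%N -> k0 \in K ->
  perm_eq (compositions_from n K)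
    ([:: K] :: [seq rcons g (K :\: J)
       | J : {set T} <- [seq J : {set T} <- index_enum {set T} |
           (J \proper K) && (k0 \in J)],
         g <- compositions_from n J]).
Proof.
move=> Tn K0; apply: uniq_perm => [||g]; first exact: compositions_from_uniq.
  rewrite cons_uniq; apply/andP; split.
    apply/negP => /allpairsPdep[J [g [_]]].
    rewrite mem_compositions_from //.
    by case: g => [|B [|C g]] //= /andP[_]; rewrite inE.
  apply: allpairs_uniq_dep; first by rewrite filter_uniq ?index_enum_uniq.
    by move=> J _; apply: compositions_from_uniq.
  move=> u v /allpairsPdep[J [g [sJ _ ->]]].
  move=> /allpairsPdep[J' [g' [sJ' _ ->]]] /= /rcons_inj[-> e].
  move: sJ sJ'; rewrite !mem_filter.
  move=> /andP[/andP[/proper_sub JK _] _] /andP[/andP[/proper_sub JK' _] _].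
  suff -> : J = J' by [].
  by rewrite -(setDK JK) e setDK.
rewrite mem_compositions_from // inE; case/lastP: g => [|g L].
  rewrite [head _ _]/= inE andbF; apply/esym/negP => /allpairsPdep[J [g [_ _]]].
  by case: g.
rewrite set_composition_rcons; apply/andP/orP.
  move=> [/and3P[L0 LK gL] k0g]; case: g => [|B g] in gL k0g *.
    left; move: gL; rewrite set_composition_nil setD_eq0 => KL.
    by rewrite (_ : L = K) //; apply/eqP; rewrite eqEsubset LK.
  right; apply/allpairsPdep; exists (K :\: L), (B :: g).
  have k0L : k0 \in K :\: L.
    case/and3P: gL => _ _ /eqP <-; rewrite big_cons inE.
    by rewrite [k0 \in B]k0g.
  split; last by rewrite setDK.
    by rewrite mem_filter setD_proper // k0L mem_index_enum.
  by rewrite mem_compositions_from // gL.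
case=> [/eqP e|/allpairsPdep[J [h [sJ sh e]]]].
  case: g e => [[->]|B [|C g] []] //.
  rewrite subxx setDv set_composition_nil eqxx K0 andbT; split=> //.
  by rewrite andbT; apply/set0Pn; exists k0.
have [-> ->] := rcons_inj e.
move: sJ sh; rewrite mem_filter mem_compositions_from //.
move=> /andP[/andP[JK k0J] _] /andP[hJ k0h].
rewrite (setDK (proper_sub JK)) hJ subsetDl setD_eq0 !andbT; split;
  last by case: (h) k0h; rewrite ?inE.
by case/properP: JK => _ [x xK xJ]; apply/negP => /subsetP/(_ x xK); apply/negP.
Qed.

(** Moving a last block [K :\: J] out of the sum for [K] flips the sign and
    leaves the sum for [J]; only the composition with one block is left over. *)
Lemma composition_sum_rec n K : (#|T| <= n)%N -> k0 \in K -> c set0 = 1 ->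
  c K = \sum_(J : {set T} | (J \subset K) && (k0 \in J))
          composition_sum n J * c (K :\: J).
Proof.
move=> Tn K0 c0; rewrite (bigD1 K) ?subxx //= setDv c0 mulr1.
rewrite (composition_sumE n K) (perm_big _ (compositions_from_split Tn K0)) /=.
rewrite big_cons /sign_weight /= expr0 mul1r big_seq1 -addrA.
rewrite -[LHS]addr0; congr (_ + _); apply/esym/eqP; rewrite addr_eq0.
rewrite big_allpairs_dep big_filter -sumrN; apply/eqP.
apply: eq_big => [J|J /andP[JK k0J]].
  by rewrite properEneq; case: (J != K); rewrite /= ?andbT ?andbF.
rewrite composition_sumE mulr_suml -sumrN; rewrite big_seq [RHS]big_seq.
apply: eq_bigr => g; rewrite mem_compositions_from // => /andP[_ k0g].
rewrite size_rcons -cats1 big_cat big_seq1 /= mulrA.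
case: g k0g => [|B g]; first by rewrite inE.
move=> _; rewrite /sign_weight.
by rewrite /= exprS mulN1r mulNr mulNr.
Qed.

End CompositionSum.
End SetCompositions.

(** * Primitivity and leading term of the generators *)

Lemma malg_bar A B : << bar A B >> = << A >> * << B >> :> NCSym.
Proof. exact: esym (malgMU _ _ _). Qed.

Lemma malg_compose_parts (A : setpart) (g : seq {set 'I_(nparts A)}) :
  << compose_parts g >> = \prod_(K <- g) << std_subparts K >> :> NCSym.
Proof.
exact: (big_morph (fun B : setpart => << B >> : NCSym) malg_bar erefl).
Qed.

Lemma signZ (M : monomType) n (x : {malg rat[M]}) :
  (-1) ^+ n *: x = (-1) ^+ n * x.
Proof.
elim: n => [|n IH]; first by rewrite !expr0 scale1r mul1r.
by rewrite !exprS -scalerA IH scaleN1r -mulrA mulN1r.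
Qed.

Section PrimitiveElements.
Variable A : setpart.
Hypothesis A0 : (0 < nparts A)%N.
Let k0 : 'I_(nparts A) := Ordinal A0.
Let c (K : {set 'I_(nparts A)}) : NCSym := << std_subparts K >>.

Lemma composition_from_1E g :
  composition_from_1 g =
  set_composition [set: 'I_(nparts A)] g && (k0 \in head set0 g).
Proof.
congr (_ && _); apply/existsP/idP => [[k /andP[/eqP k_0 kg]]|kg]; last first.
  by exists k0; rewrite eqxx.
by rewrite (_ : k0 = k) //; apply: val_inj.
Qed.

Lemma p_eltE : p_elt A = composition_sum k0 c (nparts A) setT.
Proof.
apply: eq_big => [g|g _]; first exact: composition_from_1E.
by rewrite signZ malg_compose_parts.
Qed.

Lemma std_subparts_set0 : c set0 = 1.
Proof. by rewrite /c std_subpartsE subparts0 std0. Qed.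

Lemma coproduct_std_subparts K :
  coproduct (c K) = \sum_(X : {set 'I_(nparts A)} | X \subset K)
    tensor (c X) (c (K :\: X)).
Proof.
rewrite /c std_subpartsE coproduct_std; last first.
  exact: partition_sub (subparts_sub K) (setpartP A).
rewrite (big_fpowerset_set _ _ (@part_inj A)); apply: eq_bigr => X _.
by rewrite -subpartsD -!std_subpartsE tensorU.
Qed.

Lemma p_elt_primitive : primitive (p_elt A).
Proof.
rewrite /primitive p_eltE; have card_n : (#|'I_(nparts A)| <= nparts A)%N.
  by rewrite card_ord.
apply: (primitive_of_recursion coproductD coproductM _ tensorDr tensorM
  tensor11 std_subparts_set0 coproduct_std_subparts (k0 := k0)).
- by move=> y x x'; apply: tensorDl.
- by move=> K K0; apply: composition_sum_rec => //; apply: std_subparts_set0.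
- by rewrite inE.
Qed.

(** The term [A] comes from the only composition with a single block; each
    remaining term is a product of at least two set partitions. *)
Lemma p_elt_lead :
  p_elt A = << A >> +
    \sum_(g : (nparts A).-bseq {set 'I_(nparts A)}
            | composition_from_1 g && (1 < size g)%N)
      (-1) ^+ (size g).-1 *: << compose_parts g >>.
Proof.
have sz : (size [:: [set: 'I_(nparts A)]] <= nparts A)%N by [].
rewrite /p_elt (bigD1 (Bseq sz)) /=; last first.
  rewrite composition_from_1E /= inE andbT (set_composition_rcons _ [::]).
  rewrite subxx setDv set_composition_nil eqxx !andbT.
  by apply/set0Pn; exists k0.
rewrite expr0 scale1r; congr (_ + _).
  by rewrite malg_compose_parts big_seq1 std_subpartsE subpartsT std_setpart.
apply: eq_bigl => g; case: (boolP (composition_from_1 g)) => //= cg.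
move: cg; rewrite composition_from_1E -val_eqE /=.
case: g => -[|B [|C g]] /= _; rewrite ?inE ?andbF //.
  2: by move=> _; rewrite eqseq_cons andbF.
rewrite (set_composition_rcons _ [::]) set_composition_nil setD_eq0.
move=> /andP[/and3P[_ BT TB] _]; rewrite (_ : B = setT) ?eqxx //.
by apply/eqP; rewrite eqEsubset BT.
Qed.

End PrimitiveElements.

(** * Unique factorization into atomic set partitions *)

Local Notation atom := {A : setpart | atomic A} (only parsing).

Section Factorization.
Local Open Scope fset_scope.

Lemma setpart_part_neq0 (A : setpart) a :
  a \in (A : set_family) -> exists2 x, x \in a & (0 < x <= degree A)%N.
Proof.
move=> aA; have [A0 _ _] := partition_ofP _ _ (setpartP A).
have [x xa] : exists x, x \in a by apply/fset0Pn; apply: contraNneq A0 => <-.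
exists x => //; rewrite -in_interval_1 -setpart_cover.
by apply/fcoverP; exists a.
Qed.

Lemma degree_emptyp : degree emptyp = 0%N.
Proof. by rewrite /degree /fcover big_seq_fset0 cardfs0. Qed.

Lemma degree_std (B : set_family) :
  partition_of (fcover B) B -> degree (std B) = degree B.
Proof. by move=> pB; rewrite val_std // degree_standardize. Qed.

(** A subfamily that partitions an initial interval lies below the rest of the
    family, so the two standardizations multiply to the whole. *)
Lemma not_atomic_split (A : setpart) : A != emptyp -> ~~ atomic A ->
  exists B C : setpart, [/\ B != emptyp, C != emptyp & A = bar B C].
Proof.
move=> A0; rewrite negb_and -eqn0Ngt negbK => /orP[/eqP/degree0 e|].
  by rewrite e eqxx in A0.
case/existsP=> m /andP[m0 /existsP[[B BA] /= pB]].
have {}BA : B `<=` A by rewrite -fpowersetE.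
have cB : fcover B = interval_1 m by have /partition_ofP[] := pB.
have [_ tA cA] := partition_ofP _ _ (setpartP A).
have pB' : partition_of (fcover B) B by rewrite cB.
have pC : partition_of (fcover (A `\` B)) (A `\` B).
  exact: partition_sub (fsubsetDl _ _) (setpartP A).
have BC : {in fcover B & fcover (A `\` B), forall x y, (x < y)%N}.
  move=> x y; rewrite cB in_interval_1 => /andP[_ xm] yC.
  apply: leq_ltn_trans xm _; rewrite ltnNge; apply/negP => ym.
  have /fcoverP[a] := yC; rewrite inE => /andP[aB aA] ya.
  have : y \in fcover A by apply/fcoverP; exists a.
  rewrite cA in_interval_1 => /andP[y0 _].
  have : y \in fcover B by rewrite cB in_interval_1 y0.
  case/fcoverP=> b bB yb; have bA := fsubsetP BA b bB.
  by move: aB; rewrite (tA a b y aA bA ya yb) bB.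
have AE : A = bar (std B) (std (A `\` B)).
  rewrite -(stdU pB' pC BC) (_ : B `|` _ = A) ?std_setpart //.
  apply/fsetP => a; rewrite !inE; case: (boolP (a \in B)) => //= aB.
  by rewrite (fsubsetP BA).
exists (std B), (std (A `\` B)); split=> //.
  apply: contraTneq m0 => /(congr1 (fun X : setpart => degree X)).
  by rewrite degree_std // degree_emptyp /degree cB card_interval_1 => ->.
have dB : degree (std B) = m.
  by rewrite degree_std // /degree cB card_interval_1.
have dA : degree A = (m + degree (std (A `\` B)))%N.
  by rewrite -dB -degree_slash -[slash _ _]/(parts (bar _ _)) -AE.
have := ltn_ord m; apply: contraTneq => C0.
by rewrite [X in (_ < X)%N]dA C0 degree_emptyp addn0 ltnn.
Qed.

Lemma degree_gt0 (A : setpart) : A != emptyp -> (0 < degree A)%N.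
Proof. by rewrite lt0n; apply: contra => /eqP/degree0 ->. Qed.

Lemma atomic_neq0 (A : setpart) : atomic A -> A != emptyp.
Proof. by case/andP=> + _; apply: contraTneq => ->; rewrite degree_emptyp. Qed.

Lemma nparts_gt0 (A : setpart) : A != emptyp -> (0 < nparts A)%N.
Proof.
by rewrite cardfs_gt0; apply: contra => /eqP A0; apply/eqP/val_inj.
Qed.

Lemma atomic_factorization (A : setpart) :
  exists w : seq atom, \big[mmul/mone]_(a <- w) val a == A.
Proof.
have [n] := ubnP (degree A); elim: n => // n IHn in A *; rewrite ltnS => An.
case: (eqVneq A emptyp) => [->|A0]; first by exists [::]; rewrite big_nil.
case: (boolP (atomic A)) => [aA|/(not_atomic_split A0)[B [C [B0 C0 AE]]]].
  by exists [:: Sub A aA]; rewrite big_seq1.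
have dA : degree A = (degree B + degree C)%N by rewrite AE degree_slash.
have [|u /eqP uB] := IHn B.
  by apply: leq_trans An; rewrite dA -{1}[degree B]addn0 ltn_add2l degree_gt0.
have [|v /eqP vC] := IHn C.
  by apply: leq_trans An; rewrite dA -{1}[degree C]add0n ltn_add2r degree_gt0.
by exists (u ++ v); rewrite big_cat uB vC AE.
Qed.

(** A part of [A] has an element at most [degree B], which excludes it from
    the shifted copy of [Y]. *)
Lemma bar_prefix_sub (A B X Y : setpart) :
  bar A X = bar B Y -> (degree A <= degree B)%N -> A `<=` B.
Proof.
move=> e AB; apply/fsubsetP => a aA.
have [x xa /andP[_ xA]] := setpart_part_neq0 aA.
have : a \in (bar A X : set_family) by rewrite inE aA.
rewrite e inE => /orP[//|/image_familyP[b bY e']].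
move: xa; rewrite e' => /imfsetP[y /= yb xE].
have : y \in fcover Y by apply/fcoverP; exists b.
rewrite setpart_cover in_interval_1 => /andP[y0 _].
have : (degree B < degree B)%N; last by rewrite ltnn.
apply: leq_trans (leq_trans xA AB).
by rewrite xE -{1}[degree B]addn0 ltn_add2l.
Qed.

(** [X] is recovered from [bar A X] by removing the parts of [A] and
    standardizing. *)
Lemma barI (A : setpart) : injective (bar A).
Proof.
move=> X Y e; have diff (Z : setpart) :
    Z = std ((bar A Z : set_family) `\` A).
  have -> : (bar A Z : set_family) `\` A = image_family (addn (degree A)) Z.
    apply/fsetP => z; rewrite !inE.
    case: (boolP (z \in (A : set_family))) => //=.
    move=> zA; apply/esym/negP => /image_familyP[b bZ zE].
    have [x xz /andP[_ xA]] := setpart_part_neq0 zA.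
    move: xz; rewrite zE => /imfsetP[y /= yb xE].
    have : y \in fcover Z by apply/fcoverP; exists b.
    rewrite setpart_cover in_interval_1 => /andP[y0 _].
    by move: xA; rewrite xE -{2}[degree A]addn0 leq_add2l leqNgt y0.
  by rewrite std_image ?std_setpart // => x y _ _; rewrite leq_add2l.
by rewrite (diff X) e -diff.
Qed.

(** Otherwise the parts of [A] would be parts of [B] that partition a proper
    initial interval. *)
Lemma atomic_prefix_degree (A B X Y : setpart) :
  atomic A -> atomic B -> bar A X = bar B Y -> (degree B <= degree A)%N.
Proof.
move=> aA /andP[_ aB] e; rewrite leqNgt; apply: contra aB => AB.
apply/existsP; exists (Ordinal AB); rewrite degree_gt0 ?atomic_neq0 //=.
have BA : (A : set_family) \in fpowerset B.
  by rewrite fpowersetE (bar_prefix_sub e) // ltnW.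
by apply/existsP; exists [` BA]; apply: setpartP.
Qed.

Lemma atomic_prefix_unique (A B X Y : setpart) :
  atomic A -> atomic B -> bar A X = bar B Y -> A = B /\ X = Y.
Proof.
move=> aA aB e; have dAB : degree A = degree B.
  apply/eqP; rewrite eqn_leq (atomic_prefix_degree aB aA (esym e)).
  exact: atomic_prefix_degree aA aB e.
have AB : A = B.
  apply/val_inj/eqP; rewrite eqEfsubset (bar_prefix_sub e) ?dAB //.
  by rewrite (bar_prefix_sub (esym e)) ?dAB.
by split=> //; move: e; rewrite AB => /barI.
Qed.

End Factorization.

Definition word_prod (w : seq atom) : setpart := \big[mmul/mone]_(a <- w) val a.

Lemma word_prod_cat u v : word_prod (u ++ v) = bar (word_prod u) (word_prod v).
Proof. exact: big_cat. Qed.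

Lemma word_prod_inj : injective word_prod.
Proof.
have cons a w : word_prod (a :: w) = bar (val a) (word_prod w).
  exact: big_cons.
have cons0 a w : word_prod (a :: w) <> word_prod [::].
  rewrite cons [RHS]big_nil => /bar_eq0[a0 _].
  by have := atomic_neq0 (valP a); rewrite a0 eqxx.
elim=> [|a u IHu] [|b v] //; first by move/esym/cons0.
  by move/cons0.
rewrite !cons => /(atomic_prefix_unique (valP a) (valP b))[/val_inj -> /IHu ->].
by [].
Qed.

Definition factors (A : setpart) : seq atom := xchoose (atomic_factorization A).

Lemma factorsK : cancel factors word_prod.
Proof. by move=> A; apply/eqP/(xchooseP (atomic_factorization A)). Qed.

Lemma word_prodK : cancel word_prod factors.
Proof. by move=> w; apply: word_prod_inj; rewrite factorsK. Qed.

Lemma factors_bar A B : factors (bar A B) = factors A ++ factors B.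
Proof. by apply: word_prod_inj; rewrite word_prod_cat !factorsK. Qed.

Lemma factors_eq0 A : (size (factors A) == 0%N) = (A == emptyp).
Proof.
rewrite size_eq0; apply/eqP/eqP => [A0|->].
  by rewrite -(factorsK A) A0 /word_prod big_nil.
by apply: word_prod_inj; rewrite factorsK /word_prod big_nil.
Qed.

(** * The generators are free *)

Section FreeEval.
Variables (I : choiceType) (v : I -> NCSym).

Definition word_eval (w : seq I) : NCSym := \prod_(i <- w) v i.

Lemma word_eval_cat u w : word_eval (u ++ w) = word_eval u * word_eval w.
Proof. exact: big_cat. Qed.

Lemma free_evalE y :
  free_eval v y = lin_ext (fun w : {fmonom I} => word_eval w) y.
Proof. by apply: eq_bigr => w _; rewrite mul_malgC. Qed.

Fact free_eval_is_linear : linear (free_eval v).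
Proof. by move=> c x y; rewrite !free_evalE linearP. Qed.

HB.instance Definition _ := GRing.isLinear.Build rat
  {malg rat[{fmonom I}]} NCSym *:%R (free_eval v) free_eval_is_linear.

Lemma free_evalU w : free_eval v << w >> = word_eval w.
Proof. by rewrite free_evalE lin_extU. Qed.

Lemma fmonom_mul (u w : {fmonom I}) : mmul u w = u ++ w :> seq I.
Proof. exact: fmM. Qed.

Lemma free_evalM x y : free_eval v (x * y) = free_eval v x * free_eval v y.
Proof.
move: x; apply: malg_linear_eq => [||u].
- exact: linear_comp free_eval_is_linear (malg_mul_linearl y).
- exact: linear_comp (malg_mul_linearl _) free_eval_is_linear.
move: y; apply: malg_linear_eq => [||w].
- exact: linear_comp free_eval_is_linear (malg_mul_linearr _).
- exact: linear_comp (malg_mul_linearr _) free_eval_is_linear.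
by rewrite malgMU !free_evalU fmonom_mul word_eval_cat.
Qed.

Lemma free_eval1 : free_eval v 1 = 1.
Proof. by rewrite free_evalU /word_eval fm1 big_nil. Qed.

End FreeEval.

Section CompositionBlocks.
Variable T : finType.

Lemma set_composition_block (g : seq {set T}) (K : {set T}) :
  set_composition [set: T] g -> K \in g -> K != set0.
Proof. by case/and3P=> g0 _ _; apply: contraTneq => ->. Qed.

(** Another block is nonempty and disjoint from [K]. *)
Lemma set_composition_proper (g : seq {set T}) (K : {set T}) :
  set_composition [set: T] g -> (1 < size g)%N -> K \in g -> K != setT.
Proof.
move=> cg g2 /(nthP set0)[i ig <-]; have g1 := ltnW g2.
have /and3P[_ /(pairwiseP set0) dis _] := cg.
have [j jg ij] : exists2 j, (j < size g)%N &
    [disjoint nth set0 g i & nth set0 g j].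
  case: i ig => [|i] ig; first by exists 1%N; rewrite // dis.
  by exists 0%N; rewrite // disjoint_sym dis.
have := set_composition_block cg (mem_nth set0 jg).
by apply: contraNneq => iT; move: ij; rewrite iT -setI_eq0 setTI.
Qed.

End CompositionBlocks.

Lemma std_subparts_neq0 (A : setpart) (K : {set 'I_(nparts A)}) :
  K != set0 -> std_subparts K != emptyp.
Proof.
rewrite -card_gt0 -card_subparts std_subpartsE; apply: contraTneq => K0.
have pK : partition_of (fcover (subparts K)) (subparts K).
  exact: partition_sub (subparts_sub K) (setpartP A).
by rewrite -card_standardize // -val_std // K0 cardfs0.
Qed.

Lemma degree_std_subparts (A : setpart) (K : {set 'I_(nparts A)}) :
  K != setT -> (degree (std_subparts K) < degree A)%N.
Proof.
move=> KT; have [k kK] : exists k, k \notin K.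
  by move: KT; rewrite -properT => /properP[_ [k _ kK]]; exists k.
have pK : partition_of (fcover (subparts K)) (subparts K).
  exact: partition_sub (subparts_sub K) (setpartP A).
rewrite std_subpartsE degree_std //; apply: fproper_ltn_card.
have [x xk _] := setpart_part_neq0 (mem_part k).
have [_ tA _] := partition_ofP _ _ (setpartP A).
have xA : x \in fcover A.
  by apply/fcoverP; exists (nth fset0 (ordered_parts A) k); rewrite ?mem_part.
rewrite fproperE; apply/andP; split.
  by apply/fsubsetP; apply: fcover_sub (subparts_sub K).
apply/negP => /fsubsetP/(_ x xA).
case/fcoverP=> b bK xb; have bA := fsubsetP (subparts_sub K) _ bK.
by move: bK; rewrite (tA _ _ x bA (mem_part k) xb xk) mem_subparts (negbTE kK).
Qed.

Definition p_atom (a : atom) : NCSym := p_elt (val a).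

Lemma nparts_atom (a : atom) : (0 < nparts (val a))%N.
Proof. by apply/nparts_gt0/atomic_neq0/(valP a). Qed.

Section Surjectivity.
Let gen x := exists y, free_eval p_atom y = x.

Let genD x y : gen x -> gen y -> gen (x + y).
Proof. by move=> [u <-] [w <-]; exists (u + w); rewrite linearD. Qed.

Let genZ c x : gen x -> gen (c *: x).
Proof. by move=> [u <-]; exists (c *: u); rewrite linearZ. Qed.

Let genM x y : gen x -> gen y -> gen (x * y).
Proof. by move=> [u <-] [w <-]; exists (u * w); rewrite free_evalM. Qed.

Let gen0 : gen 0.
Proof. by exists 0; rewrite linear0. Qed.

Let gen1 : gen 1.
Proof. by exists 1; apply: free_eval1. Qed.

Let gen_p a : gen (p_atom a).
Proof. by exists << fmu a >>; rewrite free_evalU /word_eval fmU big_seq1. Qed.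

(** An atomic [A] is [p_elt A] minus products of standardizations of proper
    subfamilies, whose degrees are smaller; other set partitions factor. *)
Lemma free_eval_basis A : gen << A >>.
Proof.
have [n] := ubnP (degree A); elim: n => // n IHn in A *; rewrite ltnS => An.
case: (eqVneq A emptyp) => [->|A0]; first exact: gen1.
case: (boolP (atomic A)) => [aA|/(not_atomic_split A0)[B [C [B0 C0 AE]]]].
  have A1 := nparts_gt0 A0.
  have -> : << A >> = p_elt A + (-1) *: (p_elt A - << A >>) :> NCSym.
    by rewrite scaleN1r opprB addrC subrK.
  apply: genD; first exact: (gen_p (Sub A aA)).
  apply: genZ; rewrite (p_elt_lead A1) [_ + _ - _]addrAC subrr add0r.
  apply: (big_ind gen) => // g /andP[/andP[cg _] g2]; apply: genZ.
  rewrite malg_compose_parts big_seq; apply: (big_ind gen) => // K Kg.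
  apply: IHn; apply: leq_trans An; apply: degree_std_subparts.
  exact: set_composition_proper cg g2 Kg.
have dA : degree A = (degree B + degree C)%N by rewrite AE degree_slash.
rewrite AE malg_bar; apply: genM; apply: IHn; apply: leq_trans An; rewrite dA.
  by rewrite -{1}[degree B]addn0 ltn_add2l degree_gt0.
by rewrite -{1}[degree C]add0n ltn_add2r degree_gt0.
Qed.

End Surjectivity.

Section Injectivity.

(** The filtration of the algebra by the number of atomic factors. *)
Definition factors_ge n (x : NCSym) : Prop :=
  forall A, A \in msupp x -> (n <= size (factors A))%N.

Lemma factors_ge0 n : factors_ge n 0.
Proof. by move=> A; rewrite msupp0 inE. Qed.

Lemma factors_geD n x y :
  factors_ge n x -> factors_ge n y -> factors_ge n (x + y).
Proof.
move=> hx hy A /(fsubsetP (msuppD_le _ _)).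
by rewrite inE => /orP[/hx|/hy].
Qed.

Lemma factors_geZ n c x : factors_ge n x -> factors_ge n (c *: x).
Proof. by move=> hx A /(fsubsetP (msuppZ_le _ _))/hx. Qed.

Lemma factors_geU n A : (n <= size (factors A))%N -> factors_ge n << A >>.
Proof. by move=> nA B /(fsubsetP msuppU_le); rewrite inE => /eqP ->. Qed.

Lemma factors_geM m n x y :
  factors_ge m x -> factors_ge n y -> factors_ge (m + n) (x * y).
Proof.
move=> hx hy; rewrite malgME big_seq; apply: big_ind => [||A xA].
- exact: factors_ge0.
- exact: factors_geD.
rewrite big_seq; apply: big_ind => [||B yB].
- exact: factors_ge0.
- exact: factors_geD.
move=> C /(fsubsetP msuppU_le); rewrite inE => /eqP ->.
by rewrite factors_bar size_cat leq_add ?hx ?hy.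
Qed.

Lemma factors_geW m n x : (m <= n)%N -> factors_ge n x -> factors_ge m x.
Proof. by move=> mn hx A /hx; apply: leq_trans. Qed.

Lemma size_factors_compose_parts (A : setpart) (g : seq {set 'I_(nparts A)}) :
  set0 \notin g -> (size g <= size (factors (compose_parts g)))%N.
Proof.
elim: g => // K g IH; rewrite inE negb_or eq_sym => /andP[K0 /IH gle].
rewrite /compose_parts big_cons factors_bar size_cat.
rewrite -[size (K :: g)]/(1 + size g)%N.
by apply: leq_add gle; rewrite lt0n factors_eq0 std_subparts_neq0.
Qed.

Lemma p_atom_lead (a : atom) : factors_ge 2 (p_atom a - << val a >>).
Proof.
rewrite /p_atom (p_elt_lead (nparts_atom a)) [_ + _ - _]addrAC subrr add0r.
apply: big_ind => [||g /andP[/andP[/and3P[g0 _ _] _] g2]].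
- exact: factors_ge0.
- exact: factors_geD.
apply/factors_geZ/factors_geU/(leq_trans g2).
exact: size_factors_compose_parts.
Qed.

(** The leading terms multiply: replacing one factor of the product of atomic
    basis elements by a remainder raises the number of factors. *)
Lemma word_eval_lead (w : seq atom) :
  factors_ge (size w).+1 (word_eval p_atom w - << word_prod w >>).
Proof.
elim: w => [|a w IH].
  by rewrite /word_eval /word_prod !big_nil subrr; apply: factors_ge0.
rewrite /word_eval /word_prod !big_cons -/(word_eval _ _) -/(word_prod _).
have -> : p_atom a * word_eval p_atom w - << bar (val a) (word_prod w) >> =
    (p_atom a - << val a >>) * word_eval p_atom w +
    << val a >> * (word_eval p_atom w - << word_prod w >>).
  by rewrite malg_bar mulrBl mulrBr addrA subrK.
apply: factors_geD; last first.
  rewrite -[(size _).+1]/(1 + (size w).+1)%N; apply: factors_geM => //.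
  by apply: factors_geU; rewrite lt0n factors_eq0; apply/atomic_neq0/(valP a).
apply: (@factors_geM 2 (size w)); first exact: p_atom_lead.
rewrite -[word_eval _ _](subrK << word_prod w >>).
apply: factors_geD (factors_geW (leqnSn _) IH) _.
by apply: factors_geU; rewrite word_prodK.
Qed.

Lemma word_eval_coeff (u w : seq atom) : (size u <= size w)%N ->
  (word_eval p_atom w)@_(word_prod u) = (u == w)%:R.
Proof.
move=> uw; rewrite -[word_eval _ _](subrK << word_prod w >>) mcoeffD mcoeffU1.
rewrite (inj_eq word_prod_inj) eq_sym [X in X + _]mcoeff_outdom ?add0r //.
by apply/negP => /word_eval_lead; rewrite word_prodK ltnNge uw.
Qed.

(** In the image of [y], the coefficient of the product of a word [w] of
    minimal length in the support of [y] is that of [w]: longer words only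
    contribute terms with more factors. *)
Lemma free_eval_inj : injective (free_eval p_atom).
Proof.
suff ker y : free_eval p_atom y = 0 -> y = 0.
  move=> y z e; apply/eqP; rewrite -subr_eq0; apply/eqP/ker.
  by rewrite linearB /= e subrr.
move=> ey; apply/malgP => w; rewrite mcoeff0.
have [n] := ubnP (size w); elim: n => // n IHn in w *; rewrite ltnS => wn.
have : (free_eval p_atom y)@_(word_prod w) = 0 by rewrite ey mcoeff0.
rewrite free_evalE /lin_ext raddf_sum /= => <-.
have coef (u : {fmonom atom}) : u \in msupp y ->
    (y@_u *: word_eval p_atom u)@_(word_prod w) = y@_u *+ (u == w).
  move=> yu; rewrite mcoeffZ word_eval_coeff; last first.
    rewrite leqNgt; apply: contraL yu => uw.
    by rewrite -mcoeff_eq0 IHn // (leq_trans uw).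
  by rewrite mulr_natr eq_sym.
rewrite (eq_big_seq _ coef); case: (boolP (w \in msupp y)) => [yw|yw].
  rewrite (big_fsetD1 w) //= eqxx mulr1n big_seq big1 ?addr0 // => u.
  by rewrite !inE => /andP[/negbTE -> _].
rewrite mcoeff_outdom // big_seq big1 // => u yu.
by rewrite (_ : u == w = false) //; apply: contraNF yw => /eqP <-.
Qed.

End Injectivity.

(** * The Dynkin operator *)

Section Dynkin.
Variables (U : nzRingType) (I : Type) (v : I -> U).

Fixpoint dynkin (w : seq I) : U :=
  if w is a :: w' then
    if w' is [::] then v a else v a * dynkin w' - dynkin w' * v a
  else 0.

Let prod w : U := \prod_(i <- w) v i.

Lemma dynkin_cons a w :
  dynkin (a :: w) = v a * dynkin w - dynkin w * v a + (nilp w)%:R * v a.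
Proof.
by case: w => [|b w]; rewrite /= ?mulr0 ?mul0r ?subr0 ?add0r ?mul1r ?addr0.
Qed.

Lemma splits_nil_left w :
  \sum_(ut <- splits w) (nilp ut.1)%:R * prod ut.2 = prod w.
Proof.
elim: w => [|a w IH]; first by rewrite big_seq1 mul1r.
rewrite /= big_cat !big_map /= big1 ?add0r => [|ut _]; last by rewrite mul0r.
rewrite /prod big_cons -/(prod w) -IH mulr_sumr; apply: eq_bigr => -[u t] _ /=.
by rewrite big_cons !mulrA mulr_natl mulr_natr.
Qed.

(** For nonempty [u], [dynkin (a :: u) = a dynkin u - dynkin u a], so the terms
    [dynkin u * a * t] cancel between the two halves of [splits (a :: w)]; the
    split with [u] empty contributes one more copy of the word. *)
Lemma dynkin_convolution w :
  \sum_(ut <- splits w) dynkin ut.1 * prod ut.2 = prod w *+ size w.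
Proof.
elim: w => [|a w IH]; first by rewrite big_seq1 mul0r.
transitivity (\sum_(ut <- splits w)
    (v a * (dynkin ut.1 * prod ut.2) + v a * ((nilp ut.1)%:R * prod ut.2))).
  rewrite [RHS](eq_bigr (fun ut : seq I * seq I =>
      dynkin (a :: ut.1) * prod ut.2 + dynkin ut.1 * prod (a :: ut.2))).
    by rewrite big_split /= big_cat !big_map.
  move=> ut _; rewrite dynkin_cons [prod (a :: _)]big_cons -/(prod ut.2).
  by rewrite !mulrDl mulNr !mulrA mulr_natl mulr_natr [RHS]addrAC subrK.
rewrite big_split -!mulr_sumr IH splits_nil_left /prod big_cons.
by rewrite [size (a :: w)]/= mulrSr mulrnAr.
Qed.

End Dynkin.

Lemma dynkin_morph (U V : nzRingType) (I : Type) (f : U -> V) (v : I -> U) w :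
  f 0 = 0 -> {morph f : x y / x - y} -> {morph f : x y / x * y} ->
  f (dynkin v w) = dynkin (f \o v) w.
Proof.
move=> f0 fB fM; elim: w => [|a [|b w] IH] //.
by rewrite [in LHS]/= fB !fM -/(dynkin v (b :: w)) IH.
Qed.

Lemma eq_dynkin (U : nzRingType) (I : Type) (v v' : I -> U) :
  v =1 v' -> dynkin v =1 dynkin v'.
Proof.
move=> vv'; elim=> [|a [|b w] IH] //; first exact: vv'.
by rewrite [LHS]/= [RHS]/= vv' -/(dynkin v (b :: w)) IH.
Qed.

(** * Primitive elements are Lie elements *)

Section Euler.
Variable I : choiceType.
Local Notation F := {malg rat[{fmonom I}]}.
Implicit Types (u w : {fmonom I}) (x y : F).

(** The Euler derivation of the grading by length of words. *)
Definition euler : F -> F := lin_ext (fun w => (size w)%:R *: << w >>).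

HB.instance Definition _ := GRing.Linear.copy euler
  (lin_ext (fun w : {fmonom I} => (size w)%:R *: (<< w >> : F))).

Lemma eulerU w : euler << w >> = (size w)%:R *: << w >>.
Proof. exact: lin_extU. Qed.

Lemma euler_coeff x w : (euler x)@_w = (size w)%:R * x@_w.
Proof.
elim/malg_ind: x => [|x y IHx IHy|c x IH|u].
- by rewrite linear0 mcoeff0 mulr0.
- by rewrite linearD !mcoeffD IHx IHy mulrDr.
- by rewrite linearZ !mcoeffZ IH mulrCA.
rewrite eulerU mcoeffZ mcoeffU1.
by case: eqP => [->|_]; rewrite ?mulr0.
Qed.

Lemma euler_mulU u x :
  euler (<< u >> * x) = (size u)%:R *: (<< u >> * x) + << u >> * euler x.
Proof.
move: x; apply: malg_linear_eq => [||w].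
- exact: linear_comp (lin_ext_is_linear _) (malg_mul_linearr _).
- move=> c x y; rewrite [euler _]linearP malg_mul_linearr scalerDr scalerA.
  rewrite mulrC -scalerA [<< u >> * _ in X in _ + X]malg_mul_linearr.
  by rewrite addrACA scalerDr.
rewrite malgMU !eulerU malg_scalerAr malgMU -scalerDl -natrD.
by rewrite fmonom_mul size_cat.
Qed.

Lemma euler_Umul u x :
  euler (x * << u >>) = (size u)%:R *: (x * << u >>) + euler x * << u >>.
Proof.
move: x; apply: malg_linear_eq => [||w].
- exact: linear_comp (lin_ext_is_linear _) (malg_mul_linearl _).
- move=> c x y; rewrite [euler _]linearP malg_mul_linearl scalerDr scalerA.
  rewrite mulrC -scalerA [_ * << u >> in X in _ + X]malg_mul_linearl.
  by rewrite addrACA scalerDr.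
rewrite malgMU !eulerU -scalerAl malgMU -scalerDl -natrD.
by rewrite fmonom_mul size_cat addnC.
Qed.

(** The bracketing of a word is homogeneous of the same length, and [euler] is
    a derivation. *)
Lemma euler_dynkin (w : seq I) :
  euler (dynkin (fun i => << fmu i >>) w) =
  (size w)%:R *: dynkin (fun i => << fmu i >>) w.
Proof.
have size1 i : size (fmu i) = 1%N by rewrite fmU.
have collect (V : lmodType rat) (p q : V) n :
    p + n%:R *: p - (q + n%:R *: q) = n.+1%:R *: (p - q).
  by rewrite opprD addrACA -scalerBr mulrS scalerDl scale1r.
have step i n (d : F) : euler d = n%:R *: d ->
    euler (<< fmu i >> * d - d * << fmu i >>) =
    n.+1%:R *: (<< fmu i >> * d - d * << fmu i >>).
  have eB (x y : F) : euler (x - y) = euler x - euler y by apply: linearB.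
  move=> ed; apply: etrans (eB _ _) _.
  rewrite (euler_mulU (fmu i) d) (euler_Umul (fmu i) d) ed size1 !scale1r.
  rewrite malg_scalerAr -scalerAl.
  exact: collect.
elim: w => [|i [|j w] IH]; first by rewrite linear0 scaler0.
  apply: etrans (eulerU _) _; rewrite size1; reflexivity.
exact: step IH.
Qed.

Lemma euler_ker x : euler x = 0 -> x = x@_mone *: 1.
Proof.
move=> ex; apply/malgP => w; rewrite mcoeffZ mcoeff1.
case: eqP => [->|w1]; first by rewrite mulr1.
have := euler_coeff x w; rewrite ex mcoeff0 mulr0 => /esym/eqP.
rewrite mulf_eq0 Num.Theory.pnatr_eq0 => /orP[|/eqP//].
by move/eqP/fdeg_eq0I.
Qed.

End Euler.

Section Friedrichs.

Lemma lie_primitive : lie_subalgebra primitive.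
Proof.
have p1 : tensor 1 1 = 1 := tensor11.
split; rewrite /primitive.
- by rewrite coproduct0 tensor0l tensor0r addr0.
- move=> x y px py; apply: etrans (coproductD x y) _; rewrite px py.
  by rewrite tensorDl tensorDr; exact: addrACA.
- move=> c x px; apply: etrans (coproductZ c x) _; rewrite px.
  by rewrite tensorZl tensorZr; exact: scalerDr.
- move=> x y; apply: (bracket_primitive coproductD coproductM _ tensorDr
    tensorM).
  by move=> z s t; apply: tensorDl.
Qed.

Lemma p_atom_primitive a : primitive (p_atom a).
Proof. exact/p_elt_primitive/nparts_atom. Qed.

Lemma coproduct1 : coproduct 1 = 1.
Proof.
rewrite coproduct_setpart fpowerset0 big_seq_fset1 fsetD0 std0.
by rewrite -tensorU; exact: tensor11.
Qed.

Lemma lie_dynkin (L : NCSym -> Prop) (w : seq atom) :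
  lie_subalgebra L -> (forall a, L (p_atom a)) -> L (dynkin p_atom w).
Proof.
move=> lieL Lp; elim: w => [|a [|b w] IH]; first exact: (lie0 lieL).
  exact: Lp.
exact: (lie_bracket lieL).
Qed.

Lemma free_eval_dynkin (w : seq atom) :
  free_eval p_atom (dynkin (fun a => << fmu a >>) w) = dynkin p_atom w.
Proof.
have fB : {morph free_eval p_atom : x y / x - y} by apply: linearB.
apply: etrans (dynkin_morph _ _ (linear0 _) fB (free_evalM _)) _.
by apply: eq_dynkin => a /=; rewrite free_evalU fmU /word_eval big_seq1.
Qed.

Fact free_preimage_ex A : exists y, free_eval p_atom y == << A >>.
Proof. by have [y <-] := free_eval_basis A; exists y. Qed.

Definition free_preimage_basis (A : setpart) : {malg rat[{fmonom atom}]} :=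
  xchoose (free_preimage_ex A).

Definition free_preimage : NCSym -> {malg rat[{fmonom atom}]} :=
  lin_ext free_preimage_basis.

Lemma free_preimageK : cancel free_preimage (free_eval p_atom).
Proof.
apply: malg_linear_eq => [||A].
- exact: linear_comp (free_eval_is_linear _) (lin_ext_is_linear _).
- by [].
rewrite /free_preimage lin_extU; apply/eqP.
exact: xchooseP (free_preimage_ex A).
Qed.

Lemma free_evalK : cancel (free_eval p_atom) free_preimage.
Proof. by move=> y; apply: free_eval_inj; rewrite free_preimageK. Qed.

(** The Dynkin operator carried from the free algebra to the algebra of set
    partitions through the isomorphism [free_eval p_atom]. *)
Definition dynkin_map (x : NCSym) : NCSym :=
  lin_ext (fun w : {fmonom atom} => dynkin p_atom w) (free_preimage x).

Lemma dynkin_map_linear : linear dynkin_map.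
Proof. exact: linear_comp (lin_ext_is_linear _) (lin_ext_is_linear _). Qed.

Lemma dynkin_map_word (w : seq atom) :
  dynkin_map (word_eval p_atom w) = dynkin p_atom w.
Proof.
by rewrite -[w]/(FMonom w : seq _) -free_evalU /dynkin_map free_evalK lin_extU.
Qed.

(** Composed with the coproduct, this is the convolution product of
    [dynkin_map] and the identity. *)
Definition dynkin_convolve : NCSym2 -> NCSym :=
  lin_ext (fun AB : setpart * setpart => dynkin_map << AB.1 >> * << AB.2 >>).

HB.instance Definition _ := GRing.isLinear.Build rat NCSym2 NCSym *:%R
  dynkin_convolve (lin_ext_is_linear _).

Lemma dynkin_convolve_tensor x y :
  dynkin_convolve (tensor x y) = dynkin_map x * y.
Proof.
have lc : linear dynkin_convolve := lin_ext_is_linear _.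
move: x; apply: malg_linear_eq => [||A].
- exact: linear_comp lc (tensor_linearl y).
- exact: linear_comp (malg_mul_linearl y) dynkin_map_linear.
move: y; apply: malg_linear_eq => [||B].
- exact: linear_comp lc (tensor_linearr _).
- exact: malg_mul_linearr.
by rewrite tensorU /dynkin_convolve lin_extU.
Qed.

Lemma dynkin_convolve_word (w : seq atom) :
  dynkin_convolve (coproduct (word_eval p_atom w)) =
  (size w)%:R *: word_eval p_atom w.
Proof.
have -> : coproduct (word_eval p_atom w) = \sum_(ut <- splits w)
    tensor (word_eval p_atom ut.1) (word_eval p_atom ut.2).
  apply: (coproduct_word coproductM tensorM tensor11 _ p_atom_primitive).
  exact: coproduct1.
rewrite linear_sum scaler_nat -dynkin_convolution; apply: eq_bigr => ut _.
by rewrite /= dynkin_convolve_tensor dynkin_map_word.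
Qed.

(** Both sides compute the convolution of [dynkin_map] and the identity at [x]:
    on words it is multiplication by the length, and on a primitive element
    only the term [dynkin_map x * 1] survives, as [dynkin_map] kills scalars. *)
Lemma primitive_dynkin (x : NCSym) : primitive x ->
  free_eval p_atom (euler (free_preimage x)) = dynkin_map x.
Proof.
move=> px; have lc : linear dynkin_convolve := lin_ext_is_linear _.
have -> : dynkin_map x = dynkin_convolve (coproduct x).
  have cD s t : dynkin_convolve (s + t) = dynkin_convolve s + dynkin_convolve t.
    exact: linearD.
  have D1 : dynkin_map 1 = 0.
    have := dynkin_map_word [::]; rewrite /word_eval big_nil; exact.
  have e : dynkin_convolve (coproduct x) = dynkin_map x * 1 + dynkin_map 1 * x.
    rewrite px; apply: etrans (cD _ _) _.
    by congr (_ + _); apply: dynkin_convolve_tensor.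
  by rewrite e D1 mul0r addr0 mulr1.
rewrite -{2}(free_preimageK x); move: (free_preimage x).
apply: malg_linear_eq => [||w].
- exact: linear_comp (free_eval_is_linear _) (lin_ext_is_linear _).
- apply: linear_comp (linear_comp lc _) (free_eval_is_linear _).
  exact: lin_ext_is_linear.
rewrite eulerU linearZ /= free_evalU; exact: esym (dynkin_convolve_word w).
Qed.

(** Comparing the two sides, [c] would equal twice itself. *)
Lemma primitive_scalar c : primitive (c *: 1) -> c = 0.
Proof.
rewrite /primitive coproductZ coproduct1 tensorZl tensorZr tensor11.
rewrite -[LHS]addr0 => /addrI/esym/(congr1 (fun t : NCSym2 => t@_mone)).
by rewrite mcoeffZ mcoeff1 eqxx mulr1 mcoeff0.
Qed.

Lemma primitive_lie_generated (L : NCSym -> Prop) (x : NCSym) :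
  lie_subalgebra L -> (forall a, L (p_atom a)) -> primitive x -> L x.
Proof.
move=> lieL Lp px; set y := free_preimage x.
(* Where the length is 0 the bracket vanishes, so the value of the inverse
   of 0 does not matter. *)
pose weight (w : {fmonom atom}) : rat := y@_w / (size w)%:R.
pose z : {malg rat[{fmonom atom}]} :=
  \sum_(w <- msupp y) weight w *: dynkin (fun a => << fmu a >>) w.
have Lz : L (free_eval p_atom z).
  rewrite /z linear_sum; apply: (big_ind L) => [||w _].
  - exact: lie0.
  - exact: lieD.
  rewrite linearZ /= free_eval_dynkin; apply: lieZ => //.
  exact: lie_dynkin.
have pz : primitive (free_eval p_atom z).
  rewrite /z linear_sum; apply: (big_ind primitive) => [||w _].
  - exact: lie0 lie_primitive.
  - exact: lieD lie_primitive.
  rewrite linearZ /= free_eval_dynkin; apply: (lieZ lie_primitive).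
  exact: lie_dynkin lie_primitive p_atom_primitive.
have ez : euler z = \sum_(w <- msupp y)
    y@_w *: dynkin (fun a => << fmu a >>) (w : seq atom).
  rewrite /z linear_sum; apply: eq_bigr => w _.
  rewrite linearZ /= euler_dynkin scalerA /weight.
  case: (eqVneq (size w) 0%N) => [/size0nil ->|w0]; first by rewrite !scaler0.
  by rewrite divfK // Num.Theory.pnatr_eq0.
have eyz : euler y = euler z.
  apply: free_eval_inj; rewrite (primitive_dynkin px) ez linear_sum.
  by apply: eq_bigr => w _; rewrite linearZ /= free_eval_dynkin.
have yE : y = z + (y - z)@_mone *: 1.
  rewrite -euler_ker; first by rewrite addrC subrK.
  have eB : euler (y - z) = euler y - euler z by apply: linearB.
  by rewrite eB eyz subrr.
have xE : x = free_eval p_atom z + (y - z)@_mone *: 1.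
  rewrite -[LHS](free_preimageK x) -/y {1}yE linearD linearZ /=.
  by rewrite free_eval1.
suff c0 : (y - z)@_mone = 0 by rewrite xE c0 scale0r addr0.
apply: primitive_scalar; have -> : (y - z)@_mone *: 1 =
    x + (-1) *: free_eval p_atom z :> NCSym.
  by rewrite scaleN1r [in RHS]xE addrAC subrr add0r.
exact: (lieD lie_primitive px (lieZ lie_primitive (-1) pz)).
Qed.

End Friedrichs.


Theorem corollary5 :
  (forall x : NCSym,
     lie_generated (fun y => exists2 A : setpart, atomic A & y = p_elt A) x
     <-> primitive x)
  /\ algebraically_independent (fun A : {A : setpart | atomic A} =>
                                   p_elt (val A)).
Proof.
split=> [x|]; last exact: free_eval_inj.
split=> [gx|px L lieL Lp].
  apply: (gx _ lie_primitive) => _ [A aA ->].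
  exact: (p_atom_primitive (Sub A aA)).
apply: primitive_lie_generated lieL _ px => a.
by apply: Lp; exists (val a); [apply: (valP a)|].
Qed.
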